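(* Let $\gamma\ge0$ and $u_0\in L^2(\Omega)\setminus\mathbb{S}_\gamma$. Let $g\in L^\infty(0,\infty)$ with $g\ge c_g>0$ a.e. Let $T,\tilde T>0$ and $\psi,\tilde\psi\in\dot H^{-1}(\Omega)\cap\mathbb{S}_\gamma$, and let $u,\tilde u$ be the solutions of problem (P) with initial data $u_0$ and sources $f(x,t)=g(t)\psi(x)$, $\tilde f(x,t)=g(t)\tilde\psi(x)$, respectively. If $u(T)=\tilde u(\tilde T)$, then $T=\tilde T$ and $\psi=\tilde\psi$.
   Context: Let $\Omega\subset\mathbb{R}^d$ ($d=1,2,3$) be an open bounded smooth domain, $\alpha\in(0,1)$, and $q\in L^\infty(\Omega)$, $q\ge 0$, a fixed known potential. Let $A=-\Delta+q$ with zero Dirichlet boundary condition on $L^2(\Omega)$, with eigenvalues $0<\lambda_1\le\lambda_2\le\dots\to\infty$ and $L^2$-orthonormal eigenfunctions $\{\varphi_n\}$. For $s\ge0$, $\dot H^s(\Omega)=\{v\in L^2(\Omega):\sum_n\lambda_n^s(v,\varphi_n)^2<\infty\}$, $\dot H^{-s}(\Omega)$ is its dual, and $(\cdot,\cdot)$ is the $L^2$ inner product/duality pairing. $E_{\alpha,\beta}(z)=\sum_{k\ge0}z^k/\Gamma(k\alpha+\beta)$; $F(t)v=\sum_nE_{\alpha,1}(-\lambda_nt^\alpha)(v,\varphi_n)\varphi_n$, $E(t)v=\sum_nt^{\alpha-1}E_{\alpha,\alpha}(-\lambda_nt^\alpha)(v,\varphi_n)\varphi_n$. Problem (P) is $\partial_t^\alpha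 u-\Delta u+qu=f$ in $\Omega\times(0,\infty)$, $u=0$ on $\partial\Omega$, $u(0)=u_0$, with Caputo derivative $\partial_t^\alpha u(t)=\frac1{\Gamma(1-\alpha)}\int_0^t(t-s)^{-\alpha}u'(s)\,ds$; its solution is $u(t)=F(t)u_0+\int_0^tE(t-s)f(s)\,ds$. For $\gamma\ge-1$, $\mathbb{S}_\gamma=\{v\in\dot H^{-2}(\Omega):\lim_{n\to\infty}\lambda_n^\gamma|(v,\varphi_n)|=0\}$. *)

(* Defs.v *)
From HB Require Import structures.
From mathcomp Require Import all_boot all_order all_algebra.
From mathcomp Require Import all_classical all_reals all_analysis.
Set Implicit Arguments. Unset Strict Implicit. Unset Printing Implicit Defensive.
Import Order.TTheory GRing.Theory Num.Theory.
Import numFieldNormedType.Exports.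
Local Open Scope classical_set_scope.
Local Open Scope ring_scope.

Definition Gamma (R : realType) (x : R) : R :=
  Rintegral (@lebesgue_measure R) `]0, +oo[ (fun t => t `^ (x - 1) * expR (- t)).

Definition mittag_leffler (R : realType) (a b z : R) : R :=
  limn (series (fun k : nat => z ^+ k / Gamma (k%:R * a + b))).

(** Abstract spectral data of A = -Delta + q (Dirichlet): eigenvalues
    0 < lam_1 <= lam_2 <= ... -> +oo (indexed from 0 here).  Elements of
    the spaces below are represented by their coefficient sequences
    n |-> (v, phi_n) in the L^2-orthonormal eigenbasis {phi_n}. *)
Definition spectrum (R : realType) (lam : nat -> R) : Prop :=
  0 < lam 0%N /\ (forall n, lam n <= lam n.+1) /\ lam @ \oo --> +oo.

Definition in_L2 (R : realType) (v : nat -> R) : Prop :=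
  cvgn (series (fun n => v n ^+ 2)).

(** v in \dot H^{s}(Omega) for real s (s < 0 : the dual space, characterised
    by sum_n lam_n^s (v,phi_n)^2 < oo). *)
Definition in_Hdot (R : realType) (lam : nat -> R) (s : R) (v : nat -> R) : Prop :=
  cvgn (series (fun n => lam n `^ s * v n ^+ 2)).

Definition S_set (R : realType) (lam : nat -> R) (gamma : R) (v : nat -> R) : Prop :=
  in_Hdot lam (-2) v /\ (fun n => lam n `^ gamma * `|v n|) @ \oo --> 0.

Definition in_Linfty_pos (R : realType) (g : R -> R) : Prop :=
  measurable_fun (`]0, +oo[ : set R) g /\
  exists M : R, {ae @lebesgue_measure R, forall t, 0 < t -> `|g t| <= M}.

(** n-th eigen-coefficient of the solution u(t) = F(t)u0 + int_0^t E(t-s) f(s) ds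
    of (P) with source f(x,t) = g(t) psi(x):
    (u(t),phi_n) = E_{a,1}(-lam_n t^a)(u0,phi_n)
       + (psi,phi_n) int_0^t (t-s)^(a-1) E_{a,a}(-lam_n (t-s)^a) g(s) ds. *)
Definition sol_coef (R : realType) (alpha : R) (lam : nat -> R)
    (u0 : nat -> R) (g : R -> R) (psi : nat -> R) (t : R) (n : nat) : R :=
  mittag_leffler alpha 1 (- (lam n * t `^ alpha)) * u0 n
  + psi n * Rintegral (@lebesgue_measure R) `[0, t]
      (fun s => (t - s) `^ (alpha - 1)
                * mittag_leffler alpha alpha (- (lam n * (t - s) `^ alpha)) * g s).

(* Main.v *)
Require Import Defs.
From HB Require Import structures.
From mathcomp Require Import all_boot all_order all_algebra.
From mathcomp Require Import all_classical all_reals all_analysis.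
From mathcomp Require Import ring lra measurable_realfun.
Import Order.TTheory GRing.Theory Num.Theory.
Import numFieldNormedType.Exports.
Local Open Scope classical_set_scope.
Local Open Scope ring_scope.

Set Implicit Arguments. Unset Strict Implicit. Unset Printing Implicit Defensive.

(** Put [W_b t = t^(b-1) E_{alpha,b}(- lam t^alpha)] and let [*] be the
    convolution on [[0, t]].  The Beta integral gives, term by term,
    [W_b * t^(a-1) / Gamma a = W_(a+b)], and shifting the series gives
    [W_b = t^(b-1) / Gamma b - lam W_(b+alpha)].  Everything follows from these
    two identities.

    The resolvent [w = W_alpha] satisfies a Volterra equation whose kernel
    [t^(alpha-1)] is log-convex, hence it cannot reach zero and [w > 0].
    Consequently [u = W_1] is nonnegative and nonincreasing in [t],
    [lam (1 * w)] stays bounded, and [u t = O(t^-alpha / lam)].  Then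
    [lam (1 * u)] converges to [t^(1-alpha) / Gamma (2-alpha)] as
    [lam] tends to infinity; comparing means of the monotone function [u], the
    difference [lam (u S - u T)] stays away from [0] for [S < T].

    If [u(T) = u~(T~)] with [T <> T~], the n-th coefficient of this equality
    multiplied by [lam_n^(gamma+1)] bounds [lam_n^gamma |u0_n|] by a multiple of
    [lam_n^gamma (|psi_n| + |psi~_n|)], so [u0] would lie in [S_gamma].  Hence
    [T = T~], and [psi = psi~] because the source integrals are positive. *)

(** * Affine substitution and the Gamma function *)

Section affine_substitution.
Context {R : realType}.
Notation mu := (@lebesgue_measure R).
Local Open Scope ereal_scope.

Let aff (a b : R) : measurableTypeR R -> measurableTypeR R :=
  fun x => (a * x + b)%R.

Let measurable_aff a b : measurable_fun setT (aff a b).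
Proof. by apply: measurable_funD => //; exact: measurable_funM. Qed.

(** The pushforward of [mu] under the affine map, scaled by |a|, gives every half-open interval its
    length, and such a measure is unique. *)
Lemma ge0_integral_affine (f : R -> \bar R) (a b : R) : (a != 0)%R ->
  measurable_fun [set: R] f -> (forall x, 0 <= f x) ->
  \int[mu]_x f x = `|a|%:E * \int[mu]_x f (a * x + b)%R.
Proof.
move=> a0 mf f0.
have -> : \int[mu]_x f (a * x + b)%R = \int[pushforward mu (aff a b)]_x f x.
  by rewrite ge0_integral_pushforward//; exact: measurable_aff.
have := @ge0_integral_mscale _ _ R (pushforward mu (aff a b)) setT measurableT
  (NngNum (normr_ge0 a)) f mf (fun x _ => f0 x).
move=> /= <-.
apply: eq_measure_integral => //= A mA _.
apply/lebesgue_measure_unique => //= _ [[c d]] _ <- /=.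
rewrite /mscale/= /pushforward.
have [a_gt0|a_lt0|/eqP] := ltgtP 0%R a; last by rewrite eq_sym (negbTE a0).
  have -> : aff a b @^-1` `]c, d]%classic =
      `]((c - b) / a)%R, ((d - b) / a)%R]%classic.
    apply/seteqP; split => x /=;
    by rewrite !in_itv/= /aff ltr_pdivrMr// ler_pdivlMr// ltrBlDr lerBrDr (mulrC x).
  rewrite !lebesgue_measure_itv/= !lte_fin ltr_pM2r ?invr_gt0// ltrD2r.
  rewrite gtr0_norm//; case: ifP => cd; last by rewrite mule0.
  by rewrite -!EFinB -EFinM; congr (_%:E); field.
(* A decreasing map moves the closed end to the left; the length does not see it. *)
have -> : aff a b @^-1` `]c, d]%classic =
    `[((d - b) / a)%R, ((c - b) / a)%R[%classic.
  apply/seteqP; split => x /=;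
  by rewrite !in_itv/= /aff ltr_ndivlMr// ler_ndivrMr// ltrBlDr lerBrDr (mulrC x) andbC.
rewrite !lebesgue_measure_itv/= !lte_fin ltr_nM2r ?invr_lt0// ltrD2r.
rewrite ltr0_norm//; case: ifP => cd; last by rewrite mule0.
by rewrite -!EFinB -EFinM; congr (_%:E); field.
Qed.

Lemma ge0_integral_reflect (f : R -> \bar R) (a b c : R) :
  measurable_fun [set: R] f -> (forall x, 0 <= f x) ->
  \int[mu]_(s in `[(c - b)%R, (c - a)%R]) f (c - s)%R =
  \int[mu]_(s in `[a, b]) f s.
Proof.
move=> mf f0; rewrite [RHS]integral_mkcond.
have mg : measurable_fun setT (f \_ `[a, b]).
  by apply/(measurable_restrictT _ _).1 => //; exact: measurable_funTS.
have g0 x : 0 <= (f \_ `[a, b]) x by rewrite patchE; case: ifP.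
rewrite (@ge0_integral_affine _ (-1) c)// ?oppr_eq0 ?oner_eq0// normrN1 mul1e.
rewrite integral_mkcond; apply: eq_integral => s _; rewrite !patchE.
have -> : (-1 * s + c = c - s)%R by rewrite mulN1r addrC.
by congr (if _ then _ else _); apply/idP/idP; rewrite !inE/= !in_itv/=;
  move=> /andP[h1 h2]; apply/andP; split; lra.
Qed.

End affine_substitution.

(** * Integrability and lower bounds for the Gamma integral *)

Section gamma_integrand.
Context {R : realType}.
Notation mu := (@lebesgue_measure R).

Lemma measurable_Gamma_integrand (x : R) (D : set R) :
  measurable_fun D (fun t : R => t `^ (x - 1) * expR (- t)).
Proof.
apply: measurable_funTS; apply: measurable_funM; first exact: measurable_powR.
exact: measurableT_comp.
Qed.

(** Raise y <= exp y at y = t / (2 x) to the power x. Only half of the exponent is spent, so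
    exp(-t/2) survives in the Gamma integrand. *)
Lemma powR_le_expR_half (x t : R) : 0 < x -> 0 < t ->
  t `^ x <= (2 * x) `^ x * expR (t / 2).
Proof.
move=> x0 t0; set y := t / (2 * x).
have y0 : 0 < y by rewrite divr_gt0// mulr_gt0.
have x20 : 0 < 2 * x by rewrite mulr_gt0.
have yE : t = (2 * x) * y by rewrite /y; field; rewrite gt_eqF.
rewrite {1}yE powRM; [|exact: ltW|exact: ltW].
rewrite ler_wpM2l ?powR_ge0//.
apply: (@le_trans _ _ (expR y `^ x)).
  rewrite ge0_ler_powR ?nnegrE ?expR_ge0 ?ltW//.
  by rewrite (lt_le_trans _ (expR_ge1Dx y))// ltrDr.
rewrite /powR gt_eqF ?expR_gt0// expRK ler_expR yE; lra.
Qed.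

Lemma integrable_powR_01 (x : R) : 0 < x ->
  mu.-integrable `]0, 1] (fun t => (t `^ (x - 1))%:E).
Proof.
move=> x0; apply/integrableP; split.
  by apply/measurable_EFinP/measurable_funTS; exact: measurable_powR.
(* Away from 0 the primitive t^x / x applies, and all the integrals stay below 1 / x. The offset 2
   keeps the left end strictly below 1. *)
pose F (n : nat) : set R := `[n.+2%:R^-1, 1]%classic.
have F0 n t : F n t -> 0 < t.
  by rewrite /F/= in_itv/= => /andP[+ _]; apply: lt_le_trans; rewrite invr_gt0.
have FU : `]0%R, 1%R]%classic = \bigcup_n F n.
  apply/seteqP; split => t /=.
    rewrite in_itv/= => /andP[t0 t1].
    have [n nt] := ltr_add_invr t0; rewrite add0r in nt.
    exists n => //=; rewrite /F/= in_itv/= t1 andbT (le_trans _ (ltW nt))//.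
    by rewrite lef_pV2 ?posrE// ler_nat.
  move=> [n _ Fnt]; rewrite in_itv/= (F0 _ _ Fnt)/=.
  by move: Fnt; rewrite /F/= in_itv/= => /andP[].
rewrite FU.
under eq_integral do rewrite gee0_abs ?lee_fin ?powR_ge0//.
have cv := @ge0_nondecreasing_set_cvg_integral _ (measurableTypeR R) R F
  (fun t => (t `^ (x - 1))%:E) mu.
have {}cv : (\int[mu]_(t in F n) (t `^ (x - 1))%:E @[n --> \oo] -->
    \int[mu]_(t in \bigcup_i F i) (t `^ (x - 1))%:E)%E.
  apply: cv.
  - move=> m n mn; rewrite subsetEset => t; rewrite /F/= !in_itv/= => /andP[h ->].
    by rewrite andbT (le_trans _ h)// lef_pV2 ?posrE// ler_nat !ltnS.
  - by move=> i; exact: measurable_itv.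
  - by move=> i; apply/measurable_EFinP/measurable_funTS; exact: measurable_powR.
  - by move=> i t _; rewrite lee_fin powR_ge0.
rewrite -(cvg_lim _ cv)//.
apply: (@le_lt_trans _ _ (x^-1)%:E); last by rewrite ltry.
apply: lime_le; first by apply/cvg_ex; eexists; exact: cv.
apply: nearW => n.
have n1 : n.+2%:R^-1 < 1 :> R by rewrite invf_lt1// ltr1n.
have n0 : 0 < n.+2%:R^-1 :> R by rewrite invr_gt0.
have dF (t : R) : 0 < t -> is_derive t (1:R) (fun t => x^-1 * t `^ x) (t `^ (x - 1)).
  move=> t0; have h := is_derive1_powR x t0.
  have := @is_deriveZ _ R^o R^o (@powR R ^~ x) x^-1 t 1 _ h.
  by rewrite /GRing.scale/= mulKf ?gt_eqF.
have cF (t : R) b : 0 < t -> {for t, continuous (fun t : R => t `^ b)}.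
  move=> t0; apply: (@differentiable_continuous _ R^o R^o).
  by apply/derivable1_diffP; apply: derivable_powR; rewrite in_itv/= t0.
have cF' (t : R) b : 0 < t -> {for t, continuous (fun t : R => x^-1 * t `^ b)}.
  by move=> t0; apply: cvgM; [exact: cvg_cst|exact: cF].
rewrite (@continuous_FTC2 _ _ (fun t => x^-1 * t `^ x))//.
- rewrite powR1 mulr1 -EFinB lee_fin lerBlDr lerDl mulr_ge0 ?invr_ge0 ?powR_ge0//.
  exact: ltW.
- apply: continuous_in_subspaceT => t; rewrite inE/= in_itv/= => /andP[t0 _].
  by apply: cF; exact: lt_le_trans t0.
- split.
  + move=> t; rewrite in_itv/= => /andP[t0 _].
    by apply: ex_derive; apply: dF; exact: lt_trans t0.
  + by apply: cvg_at_right_filter; exact: cF'.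
  + by apply: cvg_at_left_filter; exact: cF'.
- move=> t; rewrite in_itv/= => /andP[t0 _]; rewrite derive1E.
  by have /(@derive_val _ _ _ _ _ _ _) := dF _ (lt_trans n0 t0).
Qed.

Lemma integrable_Gamma_integrand (x : R) : 0 < x ->
  mu.-integrable `]0, +oo[ (fun t => (t `^ (x - 1) * expR (- t))%:E).
Proof.
move=> x0.
(* Majorant: [h1] handles the singularity at 0 and [h2] the tail, as an exponential density of rate
   1/2 whose normalisation the factor 2 undoes. *)
pose h1 := (fun t : R => (t `^ (x - 1))%:E) \_ `]0, 1].
pose h2 t := ((2 * (2 * x) `^ x)%:E * (exponential_pdf 2^-1 t)%:E)%E.
have h2_ge0 t : (0 <= h2 t)%E.
  by rewrite mule_ge0 ?lee_fin ?mulr_ge0 ?powR_ge0 ?exponential_pdf_ge0.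
have h1_ge0 t : (0 <= h1 t)%E.
  by rewrite /h1 patchE; case: ifP => // _; rewrite lee_fin powR_ge0.
have ih1 : mu.-integrable `]0, +oo[ h1.
  apply: (@integrableS _ _ _ mu setT) => //.
  by rewrite -integrable_mkcond//; exact: integrable_powR_01.
have ih2 : mu.-integrable `]0, +oo[ h2.
  apply: (@integrableS _ _ _ mu setT) => //.
  rewrite /h2; apply: integrableZl => //.
  by apply: integrable_exponential_pdf; rewrite invr_gt0.
apply: (@le_integrable _ _ _ mu _ _ _ (h1 \+ h2)%E) => //.
- by apply/measurable_EFinP; exact: measurable_Gamma_integrand.
- move=> t /=; rewrite in_itv/= andbT => t0.
  rewrite [leRHS]gee0_abs; last by rewrite adde_ge0.
  rewrite ger0_norm; last by rewrite mulr_ge0 ?powR_ge0 ?expR_ge0.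
  have [t1|t1] := leP t 1.
    apply: (@le_trans _ _ (h1 t)); last by rewrite leeDl.
    rewrite /h1 patchE mem_set/= ?in_itv/= ?t0// lee_fin.
    rewrite ler_piMr ?powR_ge0// -expR0 ler_expR; lra.
  apply: (@le_trans _ _ (h2 t)); last by rewrite leeDr.
  rewrite /h2 exponential_pdfE ?(ltW t0)// lee_fin.
  rewrite mulrACA mulfV// mul1r.
  apply: (@le_trans _ _ (((2 * x) `^ x * expR (t / 2)) * expR (- t))).
    rewrite ler_wpM2r ?expR_ge0// (le_trans _ (powR_le_expR_half x0 t0))//.
    by rewrite ler_powR ?(ltW t1)//; lra.
  rewrite -mulrA -expRD.
  by rewrite (_ : t / 2 + - t = - 2^-1 * t)//; field.
- exact: integrableD.
Qed.

Lemma GammaE (x : R) : 0 < x ->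
  (\int[mu]_(t in `]0%R, +oo[) (t `^ (x - 1) * expR (- t))%:E = (Gamma x)%:E)%E.
Proof.
move=> x0; rewrite /Gamma /Rintegral fineK//.
by apply: integrable_fin_num => //; exact: integrable_Gamma_integrand.
Qed.

Lemma Gamma_ge_itv (x a c : R) : 0 < x -> 0 < a -> 0 <= c ->
  (forall t, a <= t <= a + 1 -> c <= t `^ (x - 1) * expR (- t)) -> c <= Gamma x.
Proof.
move=> x0 a0 c0 hc; rewrite -lee_fin -GammaE//.
apply: (@le_trans _ _ (\int[mu]_(t in `[a, (a + 1)%R]) (t `^ (x - 1) * expR (- t))%:E)%E).
  have -> : c%:E = (\int[mu]_(t in `[a, (a + 1)%R]) c%:E)%E.
    rewrite integral_cst//= lebesgue_measure_itv/= lte_fin ltrDl ltr01 -EFinB.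
    by rewrite addrAC subrr add0r mule1.
  apply: ge0_le_integral => //.
  by apply/measurable_EFinP; exact: measurable_Gamma_integrand.
apply: ge0_subset_integral => //.
- by apply/measurable_EFinP; exact: measurable_Gamma_integrand.
- by move=> t _; rewrite lee_fin mulr_ge0 ?powR_ge0 ?expR_ge0.
- by move=> t /=; rewrite !in_itv/= andbT => /andP[+ _]; exact: lt_le_trans.
Qed.

(** Bound the integrand from below on [a, a + 1]. As [a] is free, Gamma outgrows every geometric
    sequence, which is what the Mittag-Leffler series needs. *)
Lemma Gamma_ge_powR (x a : R) : 0 < x -> 0 < a ->
  a `^ x * ((a + 1)^-1 * expR (- (a + 1))) <= Gamma x.
Proof.
move=> x0 a0; apply: (@Gamma_ge_itv _ a) => //.
  by rewrite !mulr_ge0 ?powR_ge0 ?expR_ge0// invr_ge0 addr_ge0// ltW.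
move=> t /andP[at_ ta]; have t0 := lt_le_trans a0 at_.
rewrite mulrA powRB ?(gt_eqF t0) ?implybT// powRr1 ?(ltW t0)//.
apply: ler_pM; rewrite ?expR_ge0 ?mulr_ge0 ?powR_ge0 ?invr_ge0 ?addr_ge0 ?(ltW a0)//.
  apply: ler_pM; rewrite ?powR_ge0 ?invr_ge0 ?addr_ge0 ?(ltW a0)//.
    by rewrite ge0_ler_powR ?nnegrE ?(ltW a0) ?(ltW t0) ?(ltW x0).
  by rewrite lef_pV2 ?posrE// addr_gt0.
by rewrite ler_expR lerN2.
Qed.

Lemma Gamma_gt0 (x : R) : 0 < x -> 0 < Gamma x.
Proof.
move=> x0; apply: lt_le_trans (Gamma_ge_powR x0 ltr01).
by rewrite !mulr_gt0 ?powR_gt0 ?expR_gt0// invr_gt0.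
Qed.

End gamma_integrand.

(** * The Beta integral *)

Section beta_integral.
Context {R : realType}.
Notation mu := (@lebesgue_measure R).

(** Truncated power: convolving over the whole line then only sees [0, y]. The cut is explicit
    because [powR] does not vanish at negative numbers. *)
Let pp (a : R) : R -> R := (fun x => x `^ (a - 1)) \_ `]0, +oo[.

Let ppT (a x : R) : 0 < x -> pp a x = x `^ (a - 1).
Proof. by move=> x0; rewrite /pp patchE mem_set//= in_itv/= x0. Qed.

Let ppF (a x : R) : x <= 0 -> pp a x = 0.
Proof. by move=> x0; rewrite /pp patchE memNset//= in_itv/= andbT ltNge x0. Qed.

Let pp_ge0 (a x : R) : 0 <= pp a x.
Proof. by case: (ltP 0 x) => x0; [rewrite ppT ?powR_ge0|rewrite ppF]. Qed.

Let measurable_pp (a : R) : measurable_fun setT (pp a).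
Proof.
apply/(measurable_restrictT _ _).1 => //.
by apply: measurable_funTS; exact: measurable_powR.
Qed.

Let GammaT (a : R) : 0 < a -> (\int[mu]_x (pp a x * expR (- x))%:E = (Gamma a)%:E)%E.
Proof.
move=> a0; rewrite -GammaE// [RHS]integral_mkcond; apply: eq_integral => x _.
rewrite patchE; case: ifPn => [|]; rewrite ?inE/= ?notin_setE/= in_itv/= andbT.
  by move=> x0; rewrite ppT.
by move/negP; rewrite -leNgt => x0; rewrite ppF// mul0r.
Qed.

Let measurable_ppM (a : R) : measurable_fun setT (fun x : R => pp a x * expR (- x)).
Proof. by apply: measurable_funM => //; exact: measurableT_comp. Qed.

Let C (a b y : R) : \bar R := (\int[mu]_x (pp a x * pp b (y - x))%:E)%E.

Let measurable_ppB (b y : R) : measurable_fun setT (fun x : R => pp b (y - x)).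
Proof.
apply: (@measurableT_comp _ _ _ _ _ _ (pp b)) => //.
exact: measurable_funB.
Qed.

Let measurable_conv (a b y : R) :
  measurable_fun setT (fun x : R => pp a x * pp b (y - x)).
Proof. exact: measurable_funM. Qed.

Let C_ge0 (a b y : R) : (0 <= C a b y)%E.
Proof. by apply: integral_ge0 => x _; rewrite lee_fin mulr_ge0. Qed.

Let C_scale (a b y : R) : 0 < y -> (C a b y = (y `^ (a + b - 1))%:E * C a b 1)%E.
Proof.
move=> y0; rewrite /C (@ge0_integral_affine _ _ y 0) ?gt_eqF// ?gtr0_norm//; first last.
- by move=> x; rewrite lee_fin mulr_ge0.
- by apply/measurable_EFinP; exact: measurable_conv.
under eq_integral => x _.
  have -> : pp a (y * x + 0) = y `^ (a - 1) * pp a x.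
    rewrite addr0; case: (ltP 0 x) => x0.
      by rewrite !ppT ?mulr_gt0// powRM ?ltW.
    by rewrite !ppF ?mulr0// pmulr_rle0.
  have -> : pp b (y - (y * x + 0)) = y `^ (b - 1) * pp b (1 - x).
    have -> : y - (y * x + 0) = y * (1 - x) by ring.
    case: (ltP 0 (1 - x)) => x0.
      by rewrite !ppT ?mulr_gt0// powRM ?ltW.
    by rewrite !ppF ?mulr0// pmulr_rle0.
  rewrite mulrACA EFinM.
  over.
rewrite ge0_integralZl//; first last.
- by rewrite lee_fin mulr_ge0 ?powR_ge0.
- by move=> x _; rewrite lee_fin mulr_ge0.
- by apply/measurable_EFinP; exact: measurable_conv.
rewrite muleA -EFinM; congr (_%:E * _)%E.
have ynz : y != 0 by rewrite gt_eqF.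
rewrite -[X in X * _](powRr1 (ltW y0)) -!powRD ?ynz ?implybT//.
by congr (_ `^ _); ring.
Qed.

Let C_le0 (a b y : R) : y <= 0 -> C a b y = 0%E.
Proof.
move=> y0; rewrite /C integral0_eq// => x _.
case: (ltP 0 x) => x0; last by rewrite (ppF _ x0) mul0r.
by rewrite (@ppF b (y - x)) ?mulr0//; lra.
Qed.

(* Gamma a * Gamma b is a double integral; the shear (x, y) |-> (x, y - x)
   and Tonelli turn it into the Laplace integral of the convolution C. *)
Let GammaM (a b : R) : 0 < a -> 0 < b ->
  ((Gamma a * Gamma b)%:E = C a b 1 * (Gamma (a + b))%:E)%E.
Proof.
move=> a0 b0.
pose F (z : R * R) : \bar R := (pp a z.1 * pp b (z.2 - z.1) * expR (- z.2))%:E.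
have mF : measurable_fun setT F.
  apply/measurable_EFinP; apply: measurable_funM; first apply: measurable_funM.
  - by apply: (@measurableT_comp _ _ _ _ _ _ (pp a)).
  - apply: (@measurableT_comp _ _ _ _ _ _ (pp b)) => //.
    exact: measurable_funB.
  - apply: measurableT_comp => //.
    exact: measurableT_comp.
have F0 z : (0 <= F z)%E by rewrite lee_fin !mulr_ge0 ?expR_ge0.
have := @fubini_tonelli _ _ _ _ R mu mu F mF F0.
have -> : (\int[mu]_x \int[mu]_y F (x, y) = (Gamma a * Gamma b)%:E)%E.
  under eq_integral => x _.
    rewrite (@ge0_integral_affine _ _ 1 x) ?oner_eq0// ?normr1; first last.
    - exact: (measurableT_comp mF).
    rewrite mul1e.
    under eq_integral => y _.
      have -> : (F (x, (1 * y + x)%R) =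
        (pp a x * expR (- x))%:E * (pp b y * expR (- y))%:E)%E.
        rewrite /F/= -EFinM; congr (_%:E).
        have -> : 1 * y + x - x = y by ring.
        have -> : - (1 * y + x) = - x + - y by ring.
        by rewrite expRD; ring.
      over.
    rewrite ge0_integralZl//; first last.
    - by rewrite lee_fin mulr_ge0 ?expR_ge0.
    - by move=> y _; rewrite lee_fin mulr_ge0 ?expR_ge0.
    - by apply/measurable_EFinP; exact: measurable_ppM.
    rewrite (GammaT b0) muleC.
    over.
  rewrite ge0_integralZl//; first last.
  - by rewrite lee_fin ltW// Gamma_gt0.
  - by move=> y _; rewrite lee_fin mulr_ge0 ?expR_ge0.
  - by apply/measurable_EFinP; exact: measurable_ppM.
  by rewrite (GammaT a0) -EFinM mulrC.
move=> ->.
under eq_integral => y _.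
  have -> : (\int[mu]_x F (x, y) = C a b 1 * (pp (a + b) y * expR (- y))%:E)%E.
    transitivity ((expR (- y))%:E * C a b y)%E.
      rewrite /C -ge0_integralZl//; first last.
      - by move=> x _; rewrite lee_fin mulr_ge0.
      - by apply/measurable_EFinP; exact: measurable_conv.
      by apply: eq_integral => x _; rewrite -EFinM mulrC.
    case: (ltP 0 y) => y0.
      by rewrite C_scale// ppT// muleA -EFinM muleC mulrC.
    by rewrite C_le0// ppF// mul0r !mule0.
  over.
rewrite ge0_integralZl//; first last.
- by move=> y _; rewrite lee_fin mulr_ge0 ?expR_ge0.
- by apply/measurable_EFinP; exact: measurable_ppM.
by rewrite GammaT// addr_gt0.
Qed.

(** Finiteness of the convolution comes out here: an infinite value would make the finite product of
    the two Gamma values infinite. *)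
Let C1E (a b : R) : 0 < a -> 0 < b ->
  C a b 1 = (Gamma a * Gamma b / Gamma (a + b))%:E.
Proof.
move=> a0 b0; have := GammaM a0 b0; have := C_ge0 a b 1.
have G0 := Gamma_gt0 (addr_gt0 a0 b0).
case: (C a b 1) => [c| |] //= _.
- by rewrite -EFinM => -[->]; rewrite mulfK// gt_eqF.
- by rewrite gt0_mulye// lte_fin.
Qed.

Lemma integral_beta (a b t : R) : 0 < a -> 0 < b -> 0 < t ->
  (\int[mu]_(s in `[0%R, t]) (s `^ (a - 1) * (t - s) `^ (b - 1))%:E =
   (t `^ (a + b - 1) * (Gamma a * Gamma b / Gamma (a + b)))%:E)%E.
Proof.
move=> a0 b0 t0; rewrite EFinM -C1E// -C_scale//.
have mf (D : set R) : measurable_fun D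
    (EFin \o (fun s : R => s `^ (a - 1) * (t - s) `^ (b - 1))).
  apply/measurable_EFinP; apply: measurable_funTS; apply: measurable_funM.
    exact: measurable_powR.
  apply: (@measurableT_comp _ _ _ _ _ _ (fun x => x `^ (b - 1))).
    exact: measurable_powR.
  exact: measurable_funB.
(* The endpoints are null, and on the open interval truncated and plain powers agree. *)
rewrite -integral_itv_bndo_bndc; last exact: mf.
rewrite -integral_itv_obnd_cbnd; last exact: mf.
rewrite integral_mkcond; apply: eq_integral => s _.
rewrite patchE; case: ifPn => [|]; rewrite ?inE/= ?notin_setE/= in_itv/=.
  by move=> /andP[s0 st]; rewrite !ppT// subr_gt0.
move/negP; rewrite negb_and -!leNgt => /orP[s0|st].
  by rewrite (ppF _ s0) mul0r.
by rewrite (@ppF b (t - s)) ?mulr0// subr_le0.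
Qed.

End beta_integral.

(** * Mittag-Leffler series *)

Section power_series.
Context {R : realType}.

Let entire (c : R^nat) := forall r : R, 0 <= r -> cvgn (series (fun k => `|c k| * r ^+ k)).

Let natS_le_exp2 k : k.+1%:R <= 2 ^+ k :> R.
Proof. by rewrite -natrX ler_nat ltn_expl. Qed.

(** Since k + 1 <= 2^k, the differentiated series at r is dominated by the shifted original at 2 (r
    + 1). *)
Let entire_diffs c : entire c -> entire (pseries_diffs c).
Proof.
move=> ec r r0; set s := 2 * (r + 1).
have s0 : 0 <= s by rewrite mulr_ge0// addr_ge0.
have /cvg_ex[l hl] := ec _ s0.
apply: (@series_le_cvg _ _ (fun k => `|c k.+1| * s ^+ k.+1)).
- by move=> k; rewrite mulr_ge0// exprn_ge0.
- by move=> k; rewrite mulr_ge0// exprn_ge0.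
- move=> k; rewrite /pseries_diffs normrM mulrAC mulrC ler_wpM2l//.
  rewrite ger0_norm// /s exprMn; apply: ler_pM; rewrite ?exprn_ge0//.
    by rewrite (le_trans (natS_le_exp2 k))// ler_eXn2l ?ltr1n.
  rewrite exprS; apply: (@le_trans _ _ ((r + 1) ^+ k)).
    by rewrite lerXn2r ?nnegrE ?addr_ge0// lerDl.
  by rewrite ler_peMl ?exprn_ge0 ?addr_ge0// lerDr.
- apply/cvg_ex; exists (l - `|c 0%N| * s ^+ 0).
  have -> : series (fun k => `|c k.+1| * s ^+ k.+1) =
      (fun n => series (fun k => `|c k| * s ^+ k) n.+1 - `|c 0%N| * s ^+ 0).
    apply/funext => n; rewrite !seriesEnat/= big_nat_recl// addrAC subrr add0r.
    by [].
  apply: cvgB; last exact: cvg_cst.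
  by rewrite (cvg_shiftS (series _)).
Qed.

Let entire_cvg c z : entire c -> cvgn (pseries c z).
Proof.
move=> ec; apply: normed_cvg; rewrite /normed_series_of.
under eq_fun do rewrite normrM normrX.
exact: ec.
Qed.

Lemma continuous_pseries_entire (c : R^nat) :
  (forall r : R, 0 <= r -> cvgn (series (fun k => `|c k| * r ^+ k))) ->
  continuous (fun z : R => limn (series (fun k => c k * z ^+ k))).
Proof.
move=> ec z.
have e1 := entire_diffs ec; have e2 := entire_diffs e1.
(* Termwise differentiation at [z] asks for convergence of the series and of its first two derived
   series at a point of larger modulus. *)
have := @pseries_snd_diffs _ c (`|z| + 1) z
  (@entire_cvg _ _ ec) (@entire_cvg _ _ e1) (@entire_cvg _ _ e2).
rewrite [ltRHS]ger0_norm ?addr_ge0// ltrDl ltr01 => /(_ isT) h.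
apply: (@differentiable_continuous _ R^o R^o).
by apply/derivable1_diffP; exact: ex_derive.
Qed.

End power_series.

Section mittag_leffler.
Context {R : realType}.
Variable alpha : R.
Hypothesis alpha0 : 0 < alpha.
Notation mu := (@lebesgue_measure R).

Let arg_gt0 (b : R) k : 0 < b -> 0 < k%:R * alpha + b.
Proof. by move=> b0; rewrite ltr_wpDl// mulr_ge0// ltW. Qed.

Let Gamma_ge0 (b : R) k : 0 < b -> 0 <= (Gamma (k%:R * alpha + b))^-1.
Proof. by move=> b0; rewrite invr_ge0 ltW// Gamma_gt0// arg_gt0. Qed.

(** Choosing a^alpha = q = 2 r + 1 in [Gamma_ge_powR] gives Gamma(k alpha + b) >= C q^k, so the
    series is dominated by a geometric one of ratio r / q < 1. *)
Lemma is_cvg_mittag_leffler_ge0 (b r : R) : 0 < b -> 0 <= r ->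
  cvgn (series (fun k => r ^+ k / Gamma (k%:R * alpha + b))).
Proof.
move=> b0 r0.
pose q := 2 * r + 1; pose a := q `^ (alpha^-1).
have q0 : 0 < q by rewrite ltr_wpDl// mulr_ge0.
have a0 : 0 < a by rewrite powR_gt0.
have aE : a `^ alpha = q by rewrite /a -powRrM mulVf ?gt_eqF// powRr1// ltW.
pose C := a `^ b * ((a + 1)^-1 * expR (- (a + 1))).
have C0 : 0 < C by rewrite !mulr_gt0 ?powR_gt0 ?expR_gt0// invr_gt0 addr_gt0.
apply: (@series_le_cvg _ _ (geometric C^-1 (r / q))).
- by move=> k; rewrite mulr_ge0 ?exprn_ge0// Gamma_ge0.
- by move=> k; rewrite /= mulr_ge0 ?invr_ge0 ?(ltW C0)// exprn_ge0// divr_ge0// ltW.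
- move=> k /=; rewrite exprMn exprVn mulrCA ler_wpM2l ?exprn_ge0//.
  rewrite -invfM lef_pV2 ?posrE ?Gamma_gt0 ?arg_gt0// ?(mulr_gt0 C0 (exprn_gt0 _ q0))//.
  apply: le_trans (Gamma_ge_powR (arg_gt0 k b0) a0).
  rewrite powRD ?(gt_eqF a0) ?implybT// (mulrC _ alpha) powRrM aE powR_mulrn ?(ltW q0)//.
  by rewrite le_eqVlt; apply/orP; left; apply/eqP; rewrite /C; ring.
- apply: is_cvg_geometric_series; rewrite ger0_norm ?divr_ge0// ?(ltW q0)//.
  by rewrite ltr_pdivrMr// mul1r /q; lra.
Qed.

Lemma is_cvg_mittag_leffler (b z : R) : 0 < b ->
  cvgn (series (fun k => z ^+ k / Gamma (k%:R * alpha + b))).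
Proof.
move=> b0; apply: normed_cvg; rewrite /normed_series_of.
rewrite (_ : (fun _ => _) = (fun k => `|z| ^+ k / Gamma (k%:R * alpha + b))).
  exact: is_cvg_mittag_leffler_ge0.
by apply/funext => k; rewrite normrM normrX (ger0_norm (Gamma_ge0 k b0)).
Qed.

Lemma continuous_mittag_leffler (b : R) : 0 < b ->
  continuous (mittag_leffler alpha b).
Proof.
move=> b0.
rewrite (_ : mittag_leffler alpha b = fun z =>
    limn (series (fun k => (Gamma (k%:R * alpha + b))^-1 * z ^+ k))); last first.
  apply/funext => z; rewrite /mittag_leffler; congr (limn (series _)).
  by apply/funext => k; rewrite mulrC.
apply: continuous_pseries_entire => r r0.
rewrite (_ : (fun _ => _) = (fun k => r ^+ k / Gamma (k%:R * alpha + b))).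
  exact: is_cvg_mittag_leffler_ge0.
by apply/funext => k; rewrite mulrC (ger0_norm (Gamma_ge0 k b0)).
Qed.

Lemma mittag_leffler0 (b : R) : mittag_leffler alpha b 0 = (Gamma b)^-1.
Proof.
rewrite /mittag_leffler; apply: cvg_lim => //.
(* The partial sum of index 0 is empty; from index 1 on the sequence is constant. *)
rewrite -(cvg_shiftS (series _)) /=.
under eq_fun => n.
  rewrite seriesEnat/= big_nat_recl// big1 => [|k _]; last by rewrite expr0n/= mul0r.
  rewrite mul0r add0r expr0 mul1r addr0.
  over.
exact: cvg_cst.
Qed.

Lemma mittag_leffler_rec (b z : R) : 0 < b ->
  mittag_leffler alpha b z = (Gamma b)^-1 + z * mittag_leffler alpha (b + alpha) z.
Proof.
move=> b0; rewrite {1}/mittag_leffler; apply: cvg_lim => //.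
rewrite -(cvg_shiftS (series _)) /=.
under eq_fun => n.
  rewrite seriesEnat/= big_nat_recl// mul0r add0r expr0 mul1r.
  under eq_bigr => k _.
    rewrite exprS -mulrA.
    have -> : k.+1%:R * alpha + b = k%:R * alpha + (b + alpha).
      by rewrite -natr1; ring.
    over.
  rewrite -big_distrr/=.
  over.
apply: cvgD; first exact: cvg_cst.
apply: cvgM; first exact: cvg_cst.
by apply: is_cvg_mittag_leffler; rewrite addr_gt0.
Qed.

End mittag_leffler.

Section integrable_closure.
Context {R : realType}.
Notation mu := (@lebesgue_measure R).

Lemma integrable_itv_obnd_cbnd (f : R -> \bar R) (r : R) (b : itv_bound R) :
  mu.-integrable [set` Interval (BRight r) b] f ->
  mu.-integrable [set` Interval (BLeft r) b] f.
Proof.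
move=> /integrableP[mf f_fin]; apply/integrableP; split.
  exact/emeasurable_fun_itv_obnd_cbndP.
rewrite -integral_itv_obnd_cbnd//.
exact: measurableT_comp.
Qed.

End integrable_closure.

(** * The kernels W_b and their fractional integrals *)

Section ml_kernel.
Context {R : realType}.
Variables alpha lam : R.
Hypotheses (alpha0 : 0 < alpha) (lam0 : 0 <= lam).
Notation mu := (@lebesgue_measure R).

(** On one eigenmode, b = 1 gives the coefficient of F(t) and b = alpha that of E(t); fractional
    integration of order a moves b to b + a. *)
Definition ml_kernel (b t : R) : R :=
  t `^ (b - 1) * mittag_leffler alpha b (- (lam * t `^ alpha)).

Lemma ml_kernel_rec (b t : R) : 0 < b -> 0 < t ->
  ml_kernel b t = t `^ (b - 1) / Gamma b - lam * ml_kernel (b + alpha) t.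
Proof.
move=> b0 t0; rewrite /ml_kernel mittag_leffler_rec//.
have -> : t `^ (b + alpha - 1) = t `^ (b - 1) * t `^ alpha.
  by rewrite -powRD ?(gt_eqF t0) ?implybT//; congr (_ `^ _); ring.
by ring.
Qed.

Lemma measurable_ml_kernel (b : R) (D : set R) : 0 < b -> measurable_fun D (ml_kernel b).
Proof.
move=> b0; apply: measurable_funTS; apply: measurable_funM.
  exact: measurable_powR.
apply: (@measurableT_comp _ _ _ _ _ _ (mittag_leffler alpha b)).
  by apply: continuous_measurable_fun; exact: continuous_mittag_leffler.
by apply: measurableT_comp => //; apply: measurable_funM.
Qed.

Lemma measurable_powR_comp (p t : R) (D : set R) :
  measurable_fun D (fun s : R => (t - s) `^ p).
Proof.
apply: measurable_funTS.
apply: (@measurableT_comp _ _ _ _ _ _ (fun x => x `^ p)).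
  exact: measurable_powR.
exact: measurable_funB.
Qed.

Let beta (a b t : R) (s : R) := s `^ (b - 1) * (t - s) `^ (a - 1).

Let beta_ge0 a b t s : 0 <= beta a b t s.
Proof. by rewrite mulr_ge0 ?powR_ge0. Qed.

Let measurable_beta a b t (D : set R) : measurable_fun D (beta a b t).
Proof.
apply: measurable_funM; last exact: measurable_powR_comp.
by apply: measurable_funTS; exact: measurable_powR.
Qed.

Lemma integrable_beta (a b t : R) : 0 < a -> 0 < b -> 0 < t ->
  mu.-integrable `[0, t] (EFin \o (fun s => s `^ (b - 1) * (t - s) `^ (a - 1))).
Proof.
move=> a0 b0 t0; apply/integrableP; split.
  by apply/measurable_EFinP; exact: measurable_beta.
under eq_integral do rewrite gee0_abs ?lee_fin ?beta_ge0//.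
by rewrite integral_beta// ltry.
Qed.

Let ibeta (a b t : R) : 0 < a -> 0 < b -> 0 < t ->
  mu.-integrable `]0, t] (EFin \o beta a b t).
Proof.
move=> a0 b0 t0; apply: (@integrableS _ _ _ mu `[0, t]) => //.
  by apply: subset_itvr; rewrite bnd_simp.
exact: integrable_beta.
Qed.

Let integral_beta_oc (a b t : R) : 0 < a -> 0 < b -> 0 < t ->
  (\int[mu]_(s in `]0%R, t]) (beta a b t s)%:E =
   (t `^ (b + a - 1) * (Gamma b * Gamma a / Gamma (b + a)))%:E)%E.
Proof.
move=> a0 b0 t0; rewrite integral_itv_obnd_cbnd ?integral_beta//.
by apply/measurable_EFinP; exact: measurable_beta.
Qed.

Let cf (b : R) (k : nat) := (- lam) ^+ k / Gamma (k%:R * alpha + b).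
Let arg_gt0 (b : R) k : 0 < b -> 0 < k%:R * alpha + b.
Proof. by move=> b0; rewrite ltr_wpDl// mulr_ge0// ltW. Qed.

Let merge (b s : R) k : 0 < s ->
  s `^ (b - 1) * ((- (lam * s `^ alpha)) ^+ k / Gamma (k%:R * alpha + b)) =
  cf b k * s `^ (k%:R * alpha + b - 1).
Proof.
move=> s0; rewrite -mulNr exprMn /cf.
have -> : s `^ (k%:R * alpha + b - 1) = s `^ (b - 1) * (s `^ alpha) ^+ k.
  rewrite -powR_mulrn ?powR_ge0// -powRrM -powRD ?(gt_eqF s0) ?implybT//.
  by congr (_ `^ _); ring.
by ring.
Qed.

(** Dominated convergence for the partial sums, each term being a Beta integral. The interval is
    open at 0 because exponents of powers are added, which needs s > 0. *)
Let core (a b t : R) : 0 < a -> 0 < b -> 0 < t ->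
  mu.-integrable `]0, t] (EFin \o (fun s => ml_kernel b s * (t - s) `^ (a - 1))) /\
  (\int[mu]_(s in `]0%R, t]) (ml_kernel b s * (t - s) `^ (a - 1))%:E =
   (Gamma a * ml_kernel (b + a) t)%:E)%E.
Proof.
move=> a0 b0 t0.
have ba0 : 0 < b + a by rewrite addr_gt0.
pose F n s := (\sum_(0 <= k < n) (cf b k)%:E * (beta a (k%:R * alpha + b) t s)%:E)%E.
pose f (s : R) := (ml_kernel b s * (t - s) `^ (a - 1))%:E.
(* The series of absolute values at s = t bounds all partial sums for s <= t. *)
pose M := limn (series (fun k => (lam * t `^ alpha) ^+ k / Gamma (k%:R * alpha + b))).
pose g s := (M%:E * (beta a b t s)%:E)%E.
have iF k : mu.-integrable `]0, t]
    (fun s => (cf b k)%:E * (beta a (k%:R * alpha + b) t s)%:E)%E.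
  by apply: integrableZl => //; apply: ibeta => //; exact: arg_gt0.
have FE n s : 0 < s -> F n s = (beta a b t s *
    series (fun k => (- (lam * s `^ alpha)) ^+ k / Gamma (k%:R * alpha + b)) n)%:E.
  move=> s0; rewrite /F seriesEnat/= big_distrr/= -sumEFin.
  apply: eq_bigr => k _; rewrite -EFinM; congr (_%:E).
  by rewrite /beta [RHS]mulrAC merge// mulrA.
have mF n : measurable_fun `]0, t] (F n).
  by apply: (@measurable_int _ _ _ mu); apply: integrable_sum.
have mf : measurable_fun `]0, t] f.
  apply/measurable_EFinP; apply: measurable_funM; last exact: measurable_powR_comp.
  exact: measurable_ml_kernel.
have Ff : {ae mu, forall s, (`]0, t]%classic : set R) s -> F ^~ s @ \oo --> f s}.
  apply: aeW => s /=; rewrite in_itv/= => /andP[s0 st].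
  under eq_fun do rewrite FE//.
  apply: cvg_EFin; first by apply: nearW.
  rewrite /f /comp/= /ml_kernel mulrAC.
  apply: cvgM; first exact: cvg_cst.
  exact: is_cvg_mittag_leffler.
have ig : mu.-integrable `]0, t] g.
  by apply: integrableZl => //; exact: ibeta.
have Fg : {ae mu, forall s n, (`]0, t]%classic : set R) s -> (`|F n s| <= g s)%E}.
  apply: aeW => s n /=; rewrite in_itv/= => /andP[s0 st].
  rewrite FE// /g -EFinM lee_fin normrM (ger0_norm (beta_ge0 _ _ _ _)) mulrC.
  rewrite ler_wpM2r ?beta_ge0//.
  apply: le_trans (_ : series (fun k => (lam * t `^ alpha) ^+ k / Gamma (k%:R * alpha + b)) n <= _).
    rewrite !seriesEnat/= (le_trans (ler_norm_sum _ _ _))//.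
    apply: ler_sum => k _; rewrite normrM normrX normrN.
    have G0 : 0 <= (Gamma (k%:R * alpha + b))^-1.
      by rewrite invr_ge0 ltW// Gamma_gt0// arg_gt0.
    rewrite (ger0_norm G0) ler_wpM2r// ger0_norm ?mulr_ge0 ?powR_ge0//.
    rewrite lerXn2r ?nnegrE ?mulr_ge0 ?powR_ge0// ler_wpM2l//.
    by rewrite ge0_ler_powR ?nnegrE ?(ltW alpha0) ?(ltW s0) ?(ltW t0).
  apply: nondecreasing_cvgn_le; last first.
    by apply: is_cvg_mittag_leffler_ge0 => //; rewrite mulr_ge0 ?powR_ge0.
  apply/nondecreasing_seqP => m; rewrite seriesSr lerDl.
  by rewrite mulr_ge0 ?exprn_ge0 ?mulr_ge0 ?powR_ge0// invr_ge0 ltW// Gamma_gt0// arg_gt0.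
have [intf _ cvF] := @dominated_convergence _ _ _ mu _ (measurable_itv _) F f g mF mf Ff ig Fg.
split=> //.
apply: (@cvg_unique _ _ (\int[mu]_(s in `]0%R, t]) F n s @[n --> \oo])%E) => //.
have -> : (fun n => \int[mu]_(s in `]0%R, t]) F n s)%E = (fun n =>
   (Gamma a * (t `^ (b + a - 1) *
    series (fun k => (- (lam * t `^ alpha)) ^+ k / Gamma (k%:R * alpha + (b + a))) n))%:E).
  apply/funext => n; rewrite /F integral_sum//.
  rewrite seriesEnat/= !big_distrr/= -sumEFin; apply: eq_bigr => k _.
  rewrite integralZl//; last by apply: ibeta => //; exact: arg_gt0.
  rewrite integral_beta_oc//; last exact: arg_gt0.
  rewrite merge// -EFinM; congr (_%:E); rewrite /cf -!addrA.
  have G1 : Gamma (k%:R * alpha + b) != 0 by rewrite gt_eqF// Gamma_gt0// arg_gt0.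
  have G2 : Gamma (k%:R * alpha + (b + a)) != 0 by rewrite gt_eqF// Gamma_gt0// arg_gt0.
  by field; rewrite G1 G2.
apply: cvg_EFin; first by apply: nearW.
rewrite /comp/= /ml_kernel.
apply: cvgM; first exact: cvg_cst.
apply: cvgM; first exact: cvg_cst.
exact: is_cvg_mittag_leffler.
Qed.

Lemma integrable_ml_kernel_conv (a b t : R) : 0 < a -> 0 < b -> 0 < t ->
  mu.-integrable `[0, t] (EFin \o (fun s => ml_kernel b s * (t - s) `^ (a - 1))).
Proof.
by move=> a0 b0 t0; apply: integrable_itv_obnd_cbnd; have [] := core a0 b0 t0.
Qed.

Lemma Rintegral_ml_kernel_conv (a b t : R) : 0 < a -> 0 < b -> 0 < t ->
  \int[mu]_(s in `[0, t]) (ml_kernel b s * (t - s) `^ (a - 1)) =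
  Gamma a * ml_kernel (b + a) t.
Proof.
move=> a0 b0 t0; have [h1 h2] := core a0 b0 t0.
by rewrite -Rintegral_itv_obnd_cbnd// /Rintegral h2.
Qed.

End ml_kernel.

(** * Positivity *)

Section volterra_positive.
Context {R : realType}.
Variables (alpha lam c : R) (w : R -> R).
Notation mu := (@lebesgue_measure R).
Hypotheses (alpha01 : 0 < alpha < 1) (lam0 : 0 < lam) (c0 : 0 < c) (w0 : w 0 = 0).
Hypothesis w_cont : forall t, 0 < t -> {for t, continuous w}.
Hypothesis w_int : forall t, 0 < t ->
  mu.-integrable `[0, t] (EFin \o (fun s => w s * (t - s) `^ (alpha - 1))).
Hypothesis volterra : forall t, 0 < t -> c * w t =
  t `^ (alpha - 1) - lam * \int[mu]_(s in `[0, t]) (w s * (t - s) `^ (alpha - 1)).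

Let alpha0 : 0 < alpha. Proof. by case/andP: alpha01. Qed.
Let alpha1 : alpha < 1. Proof. by case/andP: alpha01. Qed.

(** A Beta value equal to 1 / alpha: the integral of s^(alpha-1) over [0, h] is K h^alpha. *)
Let K := Gamma alpha * Gamma 1 / Gamma (alpha + 1).

Let K0 : 0 < K.
Proof. by rewrite !mulr_gt0 ?invr_gt0 ?Gamma_gt0// addr_gt0. Qed.

Let tail_integral (t t0 : R) : t < t0 ->
  (\int[mu]_(s in `[t, t0]) ((t0 - s) `^ (alpha - 1))%:E = (K * (t0 - t) `^ alpha)%:E)%E.
Proof.
move=> tt0.
have := @ge0_integral_reflect _ (fun x => (x `^ (alpha - 1))%:E) 0 (t0 - t) t0.
rewrite subr0 (_ : t0 - (t0 - t) = t); last by ring.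
move=> -> //; last 2 first.
- by apply/measurable_EFinP; exact: measurable_powR.
- by move=> x; rewrite lee_fin powR_ge0.
have := @integral_beta R alpha 1 (t0 - t) alpha0 ltr01.
rewrite subr_gt0 tt0 => /(_ isT).
under eq_integral do rewrite subrr powRr0 mulr1.
by move=> ->; rewrite mulrC addrK.
Qed.

(* Log-convexity of the kernel s^(alpha-1). *)
Let kernel_ratio (s t t0 : R) : 0 <= s -> s < t -> t < t0 ->
  (t0 - s) `^ (alpha - 1) <= (t0 / t) `^ (alpha - 1) * (t - s) `^ (alpha - 1).
Proof.
move=> s0 st tt0.
have t_gt0 : 0 < t by rewrite (le_lt_trans s0).
have t0_gt0 : 0 < t0 by rewrite (lt_trans t_gt0).
have st0 : 0 < t - s by rewrite subr_gt0.
have st00 : 0 < t0 - s by rewrite subr_gt0 (lt_trans st).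
rewrite -powRM; [|by rewrite divr_ge0 ?ltW|exact: ltW].
have -> : alpha - 1 = - (1 - alpha) by ring.
have a1 : 0 <= 1 - alpha by rewrite subr_ge0 ltW.
have p0 : 0 < t0 / t * (t - s) by rewrite mulr_gt0// divr_gt0.
rewrite !powRN lef_pV2 ?posrE ?powR_gt0//.
rewrite ge0_ler_powR ?nnegrE ?(ltW p0) ?(ltW st00)//.
rewrite mulrAC ler_pdivrMr//; nra.
Qed.

(* At a first zero t0, pick the maximum point t of w on a short interval
   [t0 - d, t0]: log-convexity compares the history up to t with the equation at
   t, and the contribution of [t, t0] is a small multiple of w t. *)
Lemma volterra_no_first_zero (t0 : R) : 0 < t0 -> (forall s, 0 < s < t0 -> 0 < w s) -> 0 < w t0.
Proof.
move=> t0_gt0 w_gt0; rewrite ltNge; apply/negP => wt0.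
(* With d^alpha <= [eta] the recent history costs at most c / 4, while d <= t0 / 2 forces t0 / t <=
   2 and hence [rho] >= 1/2. The balance rho c - c / 4 is positive. *)
pose eta := c / (4 * (lam * K)).
have lK : 0 < lam * K by rewrite mulr_gt0.
have eta0 : 0 < eta by rewrite divr_gt0// mulr_gt0.
pose d := Num.min (t0 / 2) (eta `^ alpha^-1).
have d0 : 0 < d by rewrite lt_min powR_gt0// andbT divr_gt0.
have dt0 : d <= t0 / 2 by rewrite ge_min lexx.
have deta : d `^ alpha <= eta.
  have -> : eta = (eta `^ alpha^-1) `^ alpha.
    by rewrite -powRrM mulVf ?gt_eqF// powRr1// ltW.
  by rewrite ge0_ler_powR ?nnegrE ?powR_ge0 ?(ltW alpha0) ?(ltW d0)// ge_min lexx orbT.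
have [||t tI tmax] := @EVT_max R w (t0 - d) t0.
- by rewrite lerBlDr lerDl ltW.
- apply: continuous_in_subspaceT => s; rewrite inE/= in_itv/= => /andP[sd _].
  by apply: w_cont; lra.
have wt : 0 < w t.
  apply: lt_le_trans (tmax (t0 - d) _); first by apply: w_gt0; apply/andP; split; lra.
  by rewrite in_itv/= lexx/=; lra.
have tt0 : t < t0.
  move: tI; rewrite in_itv/= => /andP[_]; rewrite le_eqVlt => /predU1P[tE|//].
  by move: wt; rewrite tE ltNge wt0.
have dt : t0 - d <= t by move: tI; rewrite in_itv/= => /andP[].
have t_gt0 : 0 < t by lra.
set I0 := \int[mu]_(s in `[0, t0]) (w s * (t0 - s) `^ (alpha - 1)).
set It := \int[mu]_(s in `[0, t]) (w s * (t - s) `^ (alpha - 1)).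
pose rho := (t0 / t) `^ (alpha - 1).
have int0 : mu.-integrable `[0, t0] (EFin \o (fun s => w s * (t0 - s) `^ (alpha - 1))).
  exact: w_int.
have intt : mu.-integrable `[0, t] (EFin \o (fun s => w s * (t - s) `^ (alpha - 1))).
  exact: w_int.
have sub1 : `[0, t]%classic `<=` `[0, t0]%classic.
  by apply: subset_itvl; rewrite bnd_simp ltW.
have sub2 : `[0, t[%classic `<=` `[0, t]%classic.
  by apply: subset_itvl; rewrite bnd_simp.
have sub3 : `]t, t0]%classic `<=` `[0, t0]%classic.
  by apply: subset_itvr; rewrite bnd_simp ltW.
have wge0 s : 0 <= s < t0 -> 0 <= w s.
  rewrite le_eqVlt => /andP[/predU1P[<- _|s0 st]]; last by rewrite ltW// w_gt0// s0.
  by rewrite w0.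
have H1 : \int[mu]_(s in `[0, t]) (w s * (t0 - s) `^ (alpha - 1)) <= rho * It.
  have i1 : mu.-integrable `[0, t[ (EFin \o (fun s => w s * (t0 - s) `^ (alpha - 1))).
    by apply: integrableS int0 => //; exact: subset_trans sub1.
  have i2 : mu.-integrable `[0, t[
      (EFin \o (fun s => rho * (w s * (t - s) `^ (alpha - 1)))).
    by apply: integrableS (integrableZl _ rho intt).
  (* The point s = t is dropped: there (t - s)^(alpha-1) is 0 by convention and the comparison of
     kernels fails. *)
  rewrite /It -RintegralZl// -!Rintegral_itv_bndo_bndc//.
  apply: le_Rintegral => //.
  move=> s /=; rewrite in_itv/= => /andP[s0 st].
  rewrite mulrCA ler_wpM2l ?kernel_ratio//.
  by apply: wge0; rewrite s0 (lt_trans st).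
have H2 : \int[mu]_(s in `]t, t0]) (w s * (t0 - s) `^ (alpha - 1)) <= w t * (K * (t0 - t) `^ alpha).
  have itail : mu.-integrable `[t, t0] (EFin \o (fun s => (t0 - s) `^ (alpha - 1))).
    apply/integrableP; split.
      by apply/measurable_EFinP; exact: measurable_powR_comp.
    under eq_integral do rewrite gee0_abs ?lee_fin ?powR_ge0//.
    by rewrite tail_integral// ltry.
  have itail' : mu.-integrable `]t, t0] (EFin \o (fun s => (t0 - s) `^ (alpha - 1))).
    by apply: integrableS itail => //; apply: subset_itvr; rewrite bnd_simp.
  have -> : K * (t0 - t) `^ alpha = \int[mu]_(s in `]t, t0]) ((t0 - s) `^ (alpha - 1)).
    by rewrite Rintegral_itv_obnd_cbnd// /Rintegral tail_integral.
  have i1 : mu.-integrable `]t, t0] (EFin \o (fun s => w s * (t0 - s) `^ (alpha - 1))).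
    by apply: integrableS int0.
  have i2 : mu.-integrable `]t, t0] (EFin \o (fun s => w t * (t0 - s) `^ (alpha - 1))).
    exact: (integrableZl _ (w t) itail').
  rewrite -RintegralZl//; apply: le_Rintegral => //.
  move=> s /=; rewrite in_itv/= => /andP[ts st0].
  rewrite ler_wpM2r ?powR_ge0//; apply: tmax.
  by rewrite in_itv/= st0 andbT (le_trans dt)// ltW.
have I0E : I0 <= rho * It + w t * (K * (t0 - t) `^ alpha).
  have := @Rintegral_itvB R (fun s => w s * (t0 - s) `^ (alpha - 1)) (BLeft 0) (BRight t0) t int0.
  rewrite !bnd_simp (ltW t_gt0) (ltW tt0) => /(_ isT isT); rewrite -/I0; lra.
have V0 := volterra t0_gt0; have Vt := volterra t_gt0.
rewrite -/I0 in V0; rewrite -/It in Vt.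
have rhoE : rho * t `^ (alpha - 1) = t0 `^ (alpha - 1).
  rewrite /rho -powRM; [|by rewrite divr_ge0 ?ltW|exact: ltW].
  by rewrite mulfVK// gt_eqF.
have rho2 : 2^-1 <= rho.
  apply: (@le_trans _ _ ((t0 / t) `^ (-1))).
    have r0 : 0 < t0 / t by rewrite divr_gt0.
    by rewrite powR_inv1 ?(ltW r0)// lef_pV2 ?posrE// ler_pdivrMr//; lra.
  apply: ler_powR; first by rewrite ler_pdivlMr// mul1r ltW.
  by rewrite -subr_ge0 opprK subrK ltW.
have Kd : lam * (K * (t0 - t) `^ alpha) <= c / 4.
  have -> : c / 4 = (lam * K) * eta.
    by rewrite /eta; field; rewrite (gt_eqF K0) (gt_eqF lam0).
  rewrite mulrA ler_wpM2l ?(ltW lK)// (le_trans _ deta)//.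
  by rewrite ge0_ler_powR ?nnegrE ?(ltW alpha0) ?(ltW d0)//; lra.
have := ltW wt => wt_.
(* Subtract [rho] times the equation at [t] from the one at [t0]: the powers cancel by [rhoE], and
   the older history by [H1]. *)
have : c * w t0 >= w t * (rho * c - lam * (K * (t0 - t) `^ alpha)).
  rewrite V0 -rhoE.
  have := ler_wpM2l (ltW lam0) I0E; move: Vt; set x := w t; set y := K * _.
  set p := t `^ _ => Vt I0E'.
  have -> : x * (rho * c - lam * y) = rho * (c * x) - lam * (x * y) by ring.
  rewrite Vt; lra.
have : 0 < w t * (rho * c - lam * (K * (t0 - t) `^ alpha)).
  rewrite mulr_gt0// subr_gt0 (le_lt_trans Kd)//.
  apply: (@lt_le_trans _ _ (2^-1 * c)); last by rewrite ler_wpM2r// ltW.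
  by rewrite mulrC ltr_pM2r// ltf_pV2 ?posrE// ltr_nat.
move=> h1 h2; have := lt_le_trans h1 h2.
by rewrite pmulr_rgt0// ltNge wt0.
Qed.

End volterra_positive.

Section ml_kernel_positive.
Context {R : realType}.
Variables alpha lam : R.
Hypotheses (alpha01 : 0 < alpha < 1) (lam0 : 0 < lam).
Notation mu := (@lebesgue_measure R).
Notation w := (ml_kernel alpha lam alpha).

Let alpha0 : 0 < alpha. Proof. by case/andP: alpha01. Qed.
Let alpha1 : alpha < 1. Proof. by case/andP: alpha01. Qed.

Lemma continuous_ml_kernel (b t : R) : 0 < b -> 0 < t ->
  {for t, continuous (ml_kernel alpha lam b)}.
Proof.
move=> b0 t0.
have cp p : {for t, continuous (fun t : R => t `^ p)}.
  apply: (@differentiable_continuous _ R^o R^o).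
  by apply/derivable1_diffP; apply: derivable_powR; rewrite in_itv/= t0.
apply: cvgM; first exact: cp.
apply: (@cvg_comp _ _ _ (fun t => - (lam * t `^ alpha)) (mittag_leffler alpha b)); last first.
  exact: continuous_mittag_leffler.
by apply: cvgN; apply: cvgM; [exact: cvg_cst|exact: cp].
Qed.

(** Recurrence at b = alpha, with W_(2 alpha) written back as a convolution of w. *)
Let volterra t : 0 < t -> Gamma alpha * w t =
  t `^ (alpha - 1) - lam * \int[mu]_(s in `[0, t]) (w s * (t - s) `^ (alpha - 1)).
Proof.
move=> t0; rewrite Rintegral_ml_kernel_conv ?(ltW lam0)// ml_kernel_rec//.
have G0 : Gamma alpha != 0 by rewrite gt_eqF// Gamma_gt0.
by field.
Qed.

Let w_gt0_near0 : exists2 d, 0 < d & forall t, 0 < t < d -> 0 < w t.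
Proof.
have h0 : 0 < mittag_leffler alpha alpha 0 by rewrite mittag_leffler0 invr_gt0 Gamma_gt0.
have c0 := continuous_mittag_leffler alpha0 alpha0 (x := 0).
have /nbhs_ballP[e /= e0 he] : \forall z \near nbhs (0:R), 0 < mittag_leffler alpha alpha z.
  exact: (cvgr_gt _ c0).
exists ((e / lam) `^ alpha^-1); first by rewrite powR_gt0 ?divr_gt0.
move=> t /andP[t0 td]; rewrite mulr_gt0 ?powR_gt0//; apply: he.
rewrite /ball/= sub0r opprK ger0_norm ?mulr_ge0 ?powR_ge0 ?(ltW lam0)//.
rewrite mulrC -ltr_pdivlMr//.
have -> : e / lam = ((e / lam) `^ alpha^-1) `^ alpha.
  by rewrite -powRrM mulVf ?gt_eqF// powRr1// divr_ge0 ?ltW.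
by rewrite gt0_ltr_powR ?nnegrE ?powR_ge0 ?(ltW t0).
Qed.

(** The infimum of the times where w <= 0 is positive, since w > 0 near 0. Before it w > 0, hence w
    > 0 at it, and continuity carries this beyond the infimum, a contradiction. *)
Lemma ml_kernel_gt0 (t : R) : 0 < t -> 0 < w t.
Proof.
move=> t_gt0; rewrite ltNge; apply/negP => wt.
pose S : set R := [set s | 0 < s /\ w s <= 0].
have [d d0 hd] := w_gt0_near0.
have Slb : lbound S d.
  move=> s [s0 ws]; rewrite leNgt; apply/negP => sd.
  by have := hd s; rewrite s0 sd => /(_ isT); rewrite ltNge ws.
have Sinf : has_inf S by split; [exists t|exists d].
have i0 : 0 < inf S by rewrite (lt_le_trans d0)// lb_le_inf//; exists t.
have wi : 0 < w (inf S).
  (* By convention 0 to a nonzero exponent is 0, so the singular factor vanishes at 0. *)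
  have w0 : w 0 = 0 by rewrite /ml_kernel powR0 ?mul0r// subr_eq0 lt_eqF.
  have wint r : 0 < r ->
      mu.-integrable `[0, r] (EFin \o (fun s => w s * (r - s) `^ (alpha - 1))).
    by move=> r0; exact: (integrable_ml_kernel_conv alpha0 (ltW lam0) alpha0 alpha0 r0).
  apply: (volterra_no_first_zero alpha01 lam0 (Gamma_gt0 alpha0) w0
    (fun r => continuous_ml_kernel alpha0) wint volterra i0) => s /andP[s0 si]; rewrite ltNge; apply/negP => ws.
  have : inf S <= s by apply: ge_inf; [exists d|].
  by rewrite leNgt si.
have /nbhs_ballP[e /= e0 he] : \forall s \near nbhs (inf S), 0 < w s.
  exact: (cvgr_gt _ (continuous_ml_kernel alpha0 i0)).
have [s Ss si] := inf_adherent e0 Sinf.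
case: (Ss) => s0; apply/negP; rewrite -ltNge; apply: he.
have is_ : inf S <= s by apply: ge_inf => //; exists d.
by rewrite /ball/= ler0_norm ?subr_le0//; lra.
Qed.

End ml_kernel_positive.

(** Every x > 0 is t^alpha for t = x^(1/alpha), so the kernel with eigenvalue 1 suffices. *)
Lemma mittag_leffler_alpha_gt0 {R : realType} (alpha x : R) :
  0 < alpha < 1 -> 0 <= x -> 0 < mittag_leffler alpha alpha (- x).
Proof.
move=> alpha01; have alpha0 : 0 < alpha by case/andP: alpha01.
rewrite le_eqVlt => /predU1P[<-|x0].
  by rewrite oppr0 mittag_leffler0 invr_gt0 Gamma_gt0.
have t0 : 0 < x `^ alpha^-1 by rewrite powR_gt0.
have xE : (x `^ alpha^-1) `^ alpha = x.
  by rewrite -powRrM mulVf ?gt_eqF// powRr1// ltW.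
have := ml_kernel_gt0 alpha01 ltr01 t0; rewrite /ml_kernel xE mul1r.
by rewrite pmulr_rgt0// powR_gt0.
Qed.

(** * Large eigenvalues *)

Section nonincreasing_mean.
Context {R : realType}.
Notation mu := (@lebesgue_measure R).

(** This converts asymptotics of integrals into bounds on point values. *)
Lemma nonincreasing_Rintegral_mean (f : R -> R) (a b : R) :
  0 < a -> a < b -> (forall x y, 0 < x -> x <= y -> f y <= f x) ->
  mu.-integrable `[0, b] (EFin \o f) ->
  (b - a) * f b <= \int[mu]_(s in `[0, b]) f s - \int[mu]_(s in `[0, a]) f s
                <= (b - a) * f a.
Proof.
move=> a0 ab fni fint.
rewrite (@Rintegral_itvB R f (BLeft 0) (BRight b) a fint) ?bnd_simp ?(ltW a0) ?(ltW ab)//.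
have cst c : (b - a) * c = \int[mu]_(s in `]a, b]) c.
  by rewrite Rintegral_cst//= lebesgue_measure_itv/= lte_fin ab/= mulrC.
have ic c : mu.-integrable `]a, b] (EFin \o (fun=> c : R)).
  apply/integrableP; split; first by apply/measurable_EFinP; exact: measurable_cst.
  by rewrite /= integral_cst//= lebesgue_measure_itv/= lte_fin ab -EFinB -EFinM ltry.
have fint' : mu.-integrable `]a, b] (EFin \o f).
  by apply: integrableS fint => //; apply: subset_itvr; rewrite bnd_simp ltW.
by rewrite !cst; apply/andP; split; apply: le_Rintegral => // s /=;
  rewrite in_itv/= => /andP[as_ sb]; apply: fni; rewrite ?(lt_trans a0 as_)// ltW.
Qed.

End nonincreasing_mean.

Section relaxation.
Context {R : realType}.
Variables alpha lam : R.
Hypotheses (alpha01 : 0 < alpha < 1) (lam0 : 0 < lam).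
Notation mu := (@lebesgue_measure R).
Notation W := (ml_kernel alpha lam).
Notation w := (ml_kernel alpha lam alpha).
Notation u := (ml_kernel alpha lam 1).

Let alpha0 : 0 < alpha. Proof. by case/andP: alpha01. Qed.
Let alpha1 : 0 < 1 - alpha. Proof. by rewrite subr_gt0; case/andP: alpha01. Qed.
Let G1 : 0 < Gamma (1 : R). Proof. exact: Gamma_gt0. Qed.
Let lam0' : 0 <= lam. Proof. exact: ltW. Qed.

Lemma ml_kernel1 (t : R) : u t = mittag_leffler alpha 1 (- (lam * t `^ alpha)).
Proof. by rewrite /ml_kernel subrr powRr0 mul1r. Qed.

(** Given for every real t, because the weight in the source integral must be nonnegative everywhere
    after reflection. *)
Lemma ml_kernel_alpha_ge0 (t : R) : 0 <= w t.
Proof.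
apply: mulr_ge0; first exact: powR_ge0.
by apply/ltW/mittag_leffler_alpha_gt0 => //; apply: mulr_ge0; rewrite ?powR_ge0.
Qed.

Lemma integrable_ml_kernel (b t : R) : 0 < b -> 0 < t ->
  mu.-integrable `[0, t] (EFin \o W b).
Proof.
move=> b0 t0; have := integrable_ml_kernel_conv alpha0 lam0' ltr01 b0 t0.
by apply: eq_integrable => //= s _; rewrite subrr powRr0 mulr1.
Qed.

Lemma Rintegral_ml_kernel (b t : R) : 0 < b -> 0 < t ->
  \int[mu]_(s in `[0, t]) W b s = Gamma 1 * W (b + 1) t.
Proof.
move=> b0 t0; rewrite -Rintegral_ml_kernel_conv//.
by apply: eq_Rintegral => s _; rewrite subrr powRr0 mulr1.
Qed.

(** [Gamma 1] stays symbolic from here on; only its positivity is used. *)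
Lemma ml_kernel1E (t : R) : 0 < t -> u t = (Gamma 1)^-1 - lam * W (1 + alpha) t.
Proof. by move=> t0; rewrite ml_kernel_rec// subrr powRr0 mul1r. Qed.

(** As 1 = alpha + (1 - alpha), u is a positive multiple of a fractional integral of w >= 0. *)
Lemma ml_kernel1_ge0 (t : R) : 0 < t -> 0 <= u t.
Proof.
move=> t0; rewrite -(@pmulr_rge0 _ (Gamma (1 - alpha))) ?Gamma_gt0//.
rewrite [X in ml_kernel _ _ X](_ : 1 = alpha + (1 - alpha)); last by ring.
rewrite -Rintegral_ml_kernel_conv//.
by apply: Rintegral_ge0 => s _; rewrite mulr_ge0 ?powR_ge0 ?ml_kernel_alpha_ge0.
Qed.

(** By [ml_kernel1E] the decrease of u is lam times the growth of W_(1+alpha), itself a multiple of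
    the integral of w >= 0. *)
Lemma ml_kernel1_nonincreasing (s t : R) : 0 < s -> s <= t -> u t <= u s.
Proof.
move=> s0; rewrite le_eqVlt => /predU1P[->//|st].
have t0 := lt_trans s0 st.
rewrite (ml_kernel1E t0) (ml_kernel1E s0) lerD2l lerN2 (ler_pM2l lam0).
rewrite -(ler_pM2l G1) (addrC 1) -(Rintegral_ml_kernel alpha0 t0).
rewrite -(Rintegral_ml_kernel alpha0 s0) -subr_ge0.
rewrite (@Rintegral_itvB R w (BLeft 0) (BRight t) s) ?bnd_simp ?(ltW s0) ?(ltW st)//.
  by apply: Rintegral_ge0 => r _; exact: ml_kernel_alpha_ge0.
exact: integrable_ml_kernel.
Qed.

(** In the convolution of u with s^(alpha-1) that gives W_(1+alpha), replace u(s) by its smaller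
    value u(t); a Beta integral remains. *)
Lemma ml_kernel1_le (t : R) : 0 < t ->
  u t * (t `^ alpha * (Gamma 1 / Gamma (1 + alpha))) <= W (1 + alpha) t.
Proof.
move=> t0; have Ga : 0 < Gamma alpha by exact: Gamma_gt0.
rewrite -(ler_pM2l Ga) -Rintegral_ml_kernel_conv//.
have ib := @integrable_beta R alpha 1 t alpha0 ltr01 t0.
have -> : Gamma alpha * (u t * (t `^ alpha * (Gamma 1 / Gamma (1 + alpha)))) =
    u t * \int[mu]_(s in `[0, t]) (s `^ (1 - 1) * (t - s) `^ (alpha - 1)).
  by rewrite /Rintegral integral_beta//= [in RHS](addrC 1 alpha) addrK (addrC 1); ring.
rewrite -RintegralZl//.
have sub : `]0, t]%classic `<=` `[0, t]%classic.
  by apply: subset_itvr; rewrite bnd_simp.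
have i2 := integrable_ml_kernel_conv alpha0 lam0' alpha0 ltr01 t0.
have i1' : mu.-integrable `]0, t] (EFin \o (fun s => u t * (s `^ (1 - 1) * (t - s) `^ (alpha - 1)))).
  exact: integrableS (integrableZl _ (u t) ib).
have i2' : mu.-integrable `]0, t] (EFin \o (fun s => u s * (t - s) `^ (alpha - 1))).
  exact: integrableS i2.
rewrite -!Rintegral_itv_obnd_cbnd//; apply: le_Rintegral => // s /=.
rewrite in_itv/= => /andP[s0 st]; rewrite subrr powRr0 mul1r ler_wpM2r ?powR_ge0//.
exact: ml_kernel1_nonincreasing.
Qed.

(** Were W_(1+alpha) <= 0, the recurrence would give u > 0, and then [ml_kernel1_le] would make
    W_(1+alpha) positive. *)
Lemma ml_kernel_1alpha_gt0 (t : R) : 0 < t -> 0 < W (1 + alpha) t.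
Proof.
move=> t0; rewrite ltNge; apply/negP => W0.
have := ml_kernel1_le t0; rewrite leNgt => /negP; apply.
apply: (le_lt_trans W0); rewrite mulr_gt0//.
  rewrite ml_kernel1E// subr_gt0 (@le_lt_trans _ _ 0) ?invr_gt0//.
  by rewrite mulr_ge0_le0.
by rewrite mulr_gt0 ?powR_gt0// divr_gt0// Gamma_gt0// addr_gt0.
Qed.

Lemma ml_kernel_1alpha_le (t : R) : 0 < t -> lam * W (1 + alpha) t <= (Gamma 1)^-1.
Proof. by move=> t0; rewrite -subr_ge0 -ml_kernel1E// ml_kernel1_ge0. Qed.

(** Combines [ml_kernel1_le] with lam W_(1+alpha) <= 1 / Gamma 1. The exponent -alpha is kept in the
    shape of a Beta integrand. *)
Lemma ml_kernel1_decay (t : R) : 0 < t ->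
  u t <= lam^-1 * (Gamma (1 + alpha) / Gamma 1 ^+ 2) * t `^ (1 - alpha - 1).
Proof.
move=> t0; have h1 := ml_kernel1_le t0; have h2 := ml_kernel_1alpha_le t0.
have G2 : 0 < Gamma (1 + alpha) by rewrite Gamma_gt0// addr_gt0.
have ta : 0 < t `^ alpha by rewrite powR_gt0.
have -> : 1 - alpha - 1 = - alpha by ring.
rewrite powRN -(@ler_pM2r _ (t `^ alpha * (Gamma 1 / Gamma (1 + alpha)))); last first.
  by rewrite mulr_gt0// divr_gt0.
apply: (le_trans h1); rewrite -(ler_pM2l lam0) (le_trans h2)//.
rewrite le_eqVlt; apply/orP; left; apply/eqP; field.
by rewrite !gt_eqF.
Qed.

(** The middle term is W_(2-alpha), a fractional integral of u of order 1 - alpha. It is nonnegative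
    as u is, and the decay of u bounds it by a Beta integral over lam. *)
Lemma ml_kernel2_bounds (t : R) : 0 < t ->
  0 <= t `^ (1 - alpha) / Gamma (2 - alpha) - lam * W 2 t
  <= lam^-1 * (Gamma (1 + alpha) / Gamma 1 ^+ 2 *
      (t `^ (1 - alpha + (1 - alpha) - 1) *
       (Gamma (1 - alpha) / Gamma (1 - alpha + (1 - alpha))))).
Proof.
move=> t0.
have G0 : 0 < Gamma (1 - alpha) by exact: Gamma_gt0.
have b0 : 0 < 1 + (1 - alpha) by rewrite addr_gt0.
have -> : t `^ (1 - alpha) / Gamma (2 - alpha) - lam * W 2 t = W (1 + (1 - alpha)) t.
  have := @ml_kernel_rec R alpha lam alpha0 _ t b0 t0.
  rewrite (_ : 1 + (1 - alpha) + alpha = 2); last by ring.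
  rewrite (_ : 1 + (1 - alpha) - 1 = 1 - alpha); last by ring.
  by rewrite (_ : 2 - alpha = 1 + (1 - alpha)); [move=> ->|ring].
have E := Rintegral_ml_kernel_conv alpha0 lam0' alpha1 ltr01 t0.
apply/andP; split.
  rewrite -(pmulr_rge0 _ G0) -E -Rintegral_itv_obnd_cbnd; last first.
    apply: integrableS (integrable_ml_kernel_conv alpha0 lam0' alpha1 ltr01 t0) => //.
    by apply: subset_itvr; rewrite bnd_simp.
  apply: Rintegral_ge0 => s /=; rewrite in_itv/= => /andP[s0 _].
  by rewrite mulr_ge0 ?powR_ge0 ?ml_kernel1_ge0.
rewrite -(ler_pM2l G0) -E.
set c := Gamma (1 + alpha) / Gamma 1 ^+ 2.
have ib := @integrable_beta R (1 - alpha) (1 - alpha) t alpha1 alpha1 t0.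
set B := (X in _ <= _ * (_ * (_ * X))).
have -> : Gamma (1 - alpha) * (lam^-1 * (c * B)) = (lam^-1 * c) *
   \int[mu]_(s in `[0, t]) (s `^ (1 - alpha - 1) * (t - s) `^ (1 - alpha - 1)).
  by rewrite /Rintegral integral_beta//= /B; ring.
rewrite -RintegralZl//.
have sub : `]0, t]%classic `<=` `[0, t]%classic.
  by apply: subset_itvr; rewrite bnd_simp.
have i2 := integrable_ml_kernel_conv alpha0 lam0' alpha1 ltr01 t0.
have i1' : mu.-integrable `]0, t] (EFin \o (fun s =>
    lam^-1 * c * (s `^ (1 - alpha - 1) * (t - s) `^ (1 - alpha - 1)))).
  exact: integrableS (integrableZl _ (lam^-1 * c) ib).
have i2' : mu.-integrable `]0, t] (EFin \o (fun s => u s * (t - s) `^ (1 - alpha - 1))).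
  exact: integrableS i2.
rewrite -!Rintegral_itv_obnd_cbnd//; apply: le_Rintegral => // s /=.
rewrite in_itv/= => /andP[s0 st]; rewrite mulrA ler_wpM2r ?powR_ge0//.
exact: ml_kernel1_decay.
Qed.

End relaxation.

(** * Integrals against a bounded weight, and reflection *)

Section weighted_integral.
Context {R : realType}.
Notation mu := (@lebesgue_measure R).

Lemma Rintegral_weight_bounds (h g : R -> R) (t c C : R) : c <= C ->
  mu.-integrable `[0, t] (EFin \o h) -> (forall s, 0 <= h s) ->
  measurable_fun `]0, t] g ->
  {ae mu, forall s, 0 < s -> c <= g s <= C} ->
  c * \int[mu]_(s in `[0, t]) h s <= \int[mu]_(s in `[0, t]) (h s * g s)
    <= C * \int[mu]_(s in `[0, t]) h s.
Proof.
move=> cC ih h0 mg gcC.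
have ih' : mu.-integrable `]0, t] (EFin \o h).
  by apply: integrableS ih => //; apply: subset_itvr; rewrite bnd_simp.
have mh : measurable_fun `]0, t] h by apply/measurable_EFinP; exact: measurable_int ih'.
(* Clamping [g] to [c, C] changes it only on a null set of positive times, and makes the bounds hold
   pointwise. *)
pose k s := Num.max c (Num.min (g s) C).
have ck s : c <= k s by rewrite le_max lexx.
have kC s : k s <= C by rewrite ge_max cC ge_min lexx orbT.
have mk : measurable_fun `]0, t] k.
  by apply: measurable_maxr => //; exact: measurable_minr.
have ihk : mu.-integrable `]0, t] (EFin \o (fun s => h s * k s)).
  apply: (@le_integrable _ _ _ mu _ _ _
    (EFin \o (fun s => (`|c| + `|C|) * h s))) => //.
  - by apply/measurable_EFinP; exact: measurable_funM.
  - move=> s _ /=; rewrite lee_fin !normrM mulrC ler_wpM2r// [leRHS]ger0_norm ?addr_ge0//.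
    have [k0|k0] := leP 0 (k s).
      by rewrite ger0_norm// (le_trans (kC s))// (le_trans (ler_norm C))// lerDr.
    rewrite ltr0_norm//.
    by apply: (@le_trans _ _ (- c)); rewrite ?lerN2// (le_trans (ler_norm _))// normrN lerDl.
  - exact: (integrableZl _ _ ih').
have -> : \int[mu]_(s in `[0, t]) (h s * g s) = \int[mu]_(s in `]0, t]) (h s * k s).
  rewrite /Rintegral -integral_itv_obnd_cbnd; last first.
    by apply/measurable_EFinP; exact: measurable_funM.
  congr fine; apply: ae_eq_integral => //.
  - by apply/measurable_EFinP; exact: measurable_funM.
  - by apply/measurable_EFinP; exact: measurable_funM.
  - apply: filterS gcC; first exact: (ae_filter_ringOfSetsType mu).
    move=> s hs /=; rewrite in_itv/= => /andP[s0 _].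
    have /andP[cg gC] := hs s0; congr (_ * _)%:E.
    by rewrite /k min_l// max_r.
rewrite -(Rintegral_itv_obnd_cbnd ih') -!RintegralZl//.
apply/andP; split; apply: le_Rintegral => //.
- exact: (integrableZl _ _ ih').
- by move=> s _; rewrite mulrC ler_wpM2l.
- exact: (integrableZl _ _ ih').
- by move=> s _; rewrite mulrC ler_wpM2r.
Qed.

Lemma ge0_Rintegral_reflect (f : R -> R) (t : R) :
  measurable_fun setT f -> (forall s, 0 <= f s) ->
  mu.-integrable `[0, t] (EFin \o f) ->
  mu.-integrable `[0, t] (EFin \o (fun s => f (t - s))) /\
  \int[mu]_(s in `[0, t]) f (t - s) = \int[mu]_(s in `[0, t]) f s.
Proof.
move=> mf f0 /integrableP[_].
under eq_integral do rewrite gee0_abs ?lee_fin//.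
move=> fint.
have refl : (\int[mu]_(s in `[0%R, t]) (f (t - s))%:E =
    \int[mu]_(s in `[0%R, t]) (f s)%:E)%E.
  have := @ge0_integral_reflect _ (EFin \o f) 0 t t.
  rewrite subrr subr0; apply; first exact/measurable_EFinP.
  by move=> x; rewrite lee_fin.
split; last by rewrite /Rintegral refl.
apply/integrableP; split.
  apply/measurable_EFinP; apply: measurable_funTS.
  by apply: (measurableT_comp mf); exact: measurable_funB.
under eq_integral do rewrite gee0_abs ?lee_fin//.
by rewrite /= refl.
Qed.

End weighted_integral.

(** * The gap between two times for large eigenvalues *)

Section relaxation_gap.
Context {R : realType}.
Variable alpha : R.
Hypothesis alpha01 : 0 < alpha < 1.
Notation mu := (@lebesgue_measure R).

Let alpha0 : 0 < alpha. Proof. by case/andP: alpha01. Qed.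
Let alpha1 : 0 < 1 - alpha. Proof. by rewrite subr_gt0; case/andP: alpha01. Qed.

(** [L] is the limit of lam W_2 for large lam, and [l] is [kappa] times its derivative; [l]
    decreases strictly, so [L] is strictly concave. *)
Let L (t : R) := t `^ (1 - alpha) / Gamma (2 - alpha).
Let l (t : R) := t `^ (1 - alpha - 1).
Let kappa := Gamma (1 - alpha) * Gamma (1 : R).

Let kappa0 : 0 < kappa. Proof. by rewrite mulr_gt0// Gamma_gt0. Qed.

Let l_decr (x y : R) : 0 < x -> x < y -> l y < l x.
Proof.
move=> x0 xy; have y0 := lt_trans x0 xy.
rewrite /l; have -> : 1 - alpha - 1 = - alpha by ring.
rewrite !powRN ltf_pV2 ?posrE ?powR_gt0//.
by apply: gt0_ltr_powR; rewrite // nnegrE ltW.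
Qed.

Let l_int (t : R) : 0 < t -> mu.-integrable `[0, t] (EFin \o l) /\
  \int[mu]_(s in `[0, t]) l s = kappa * L t.
Proof.
move=> t0; split.
  have := @integrable_beta R 1 (1 - alpha) t ltr01 alpha1 t0.
  by apply: eq_integrable => //= s _; rewrite subrr powRr0 mulr1.
have := @integral_beta R (1 - alpha) 1 t alpha1 ltr01 t0.
under eq_integral do rewrite subrr powRr0 mulr1.
rewrite /Rintegral => ->; rewrite /= /L /kappa addrK.
rewrite (_ : 1 - alpha + 1 = 2 - alpha); last by ring.
by ring.
Qed.

Let L_mean (a b : R) : 0 < a -> a < b ->
  (b - a) * l b <= kappa * (L b - L a) <= (b - a) * l a.
Proof.
move=> a0 ab; have b0 := lt_trans a0 ab.
have [ib Eb] := l_int b0; have [_ Ea] := l_int a0.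
rewrite mulrBr -Eb -Ea; apply: nonincreasing_Rintegral_mean => // x y x0.
by rewrite le_eqVlt => /predU1P[->//|xy]; rewrite ltW// l_decr.
Qed.

(** Compare the integrals of u over the outer thirds [S, m1] and [m2, T], of equal length h: the
    first is at most h u(S), the second at least h u(T). Times lam, their difference approaches a
    positive quantity given by the concavity of [L]. *)
Lemma mittag_leffler1_gap (S T : R) : 0 < S -> S < T ->
  exists2 c : R, 0 < c & exists2 Lam : R, 0 < Lam & forall lam, Lam <= lam ->
    c <= lam * (mittag_leffler alpha 1 (- (lam * S `^ alpha)) -
                mittag_leffler alpha 1 (- (lam * T `^ alpha))).
Proof.
move=> S0 ST.
pose h := (T - S) / 3; pose m1 := S + h; pose m2 := T - h.
have h0 : 0 < h by rewrite divr_gt0// subr_gt0.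
have Sm1 : S < m1 by rewrite ltrDl.
have m12 : m1 < m2 by rewrite /m1 /m2 /h; lra.
have m2T : m2 < T by rewrite ltrBlDr ltrDl.
have m10 := lt_trans S0 Sm1; have m20 := lt_trans m10 m12; have T0 := lt_trans m20 m2T.
have hE1 : m1 - S = h by rewrite /m1 addrAC subrr add0r.
have hE2 : T - m2 = h by rewrite /m2 opprB addrCA subrr addr0.
have G10 : 0 < Gamma (1 : R) by exact: Gamma_gt0.
pose D (t : R) := Gamma (1 + alpha) / Gamma 1 ^+ 2 *
      (t `^ (1 - alpha + (1 - alpha) - 1) *
       (Gamma (1 - alpha) / Gamma (1 - alpha + (1 - alpha)))).
have D0 t : 0 <= D t.
  have ge0 x : 0 < x -> 0 <= Gamma x :> R by move=> x0; exact: ltW (Gamma_gt0 x0).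
  have := ge0 _ alpha1; have := ge0 _ (addr_gt0 alpha1 alpha1).
  have := ge0 _ (addr_gt0 ltr01 alpha0) => g1 g2 g3.
  apply: mulr_ge0; first exact: (divr_ge0 g1 (exprn_ge0 _ (ltW G10))).
  by apply: mulr_ge0; [exact: powR_ge0|exact: (divr_ge0 g3 g2)].
(* The slopes of [L] on the outer thirds are separated by [l m1] and [l m2]. *)
have [q q0 hL] : exists2 q, 0 < q & q <= L m1 - L S - (L T - L m2).
  exists (h * (l m1 - l m2) / kappa).
    by apply: divr_gt0 => //; apply: mulr_gt0 => //; rewrite subr_gt0; exact: l_decr.
  rewrite ler_pdivrMr// [leRHS]mulrC.
  have /andP[h1 _] := L_mean S0 Sm1; have /andP[_ h2] := L_mean m20 m2T.
  rewrite hE1 in h1; rewrite hE2 in h2.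
  by rewrite [leLHS]mulrBr [leRHS]mulrBr lerB.
exists (Gamma 1 * q / (2 * h)).
  by apply: divr_gt0; [exact: mulr_gt0 G10 q0|exact: mulr_gt0].
have [Ds Ds0 DsE] : exists2 Ds, 0 <= Ds & D m1 + D m2 = Ds.
  by exists (D m1 + D m2) => //; exact: addr_ge0.
have Lam0 : 0 < 2 * Ds / q + 1.
  by rewrite ltr_wpDl// divr_ge0 ?mulr_ge0// ltW.
(* From this threshold on the errors at [m1] and [m2] use up at most q / 2. At [S] and [T] the
   one-sided bound lam W_2 <= L costs nothing. Adding 1 keeps the threshold positive when [Ds] is
   0. *)
exists (2 * Ds / q + 1) => // lam hlam.
have lam0 : 0 < lam := lt_le_trans Lam0 hlam.
have small : lam^-1 * D m1 + lam^-1 * D m2 <= q / 2.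
  rewrite -mulrDr DsE mulrC ler_pdivrMr//.
  have : 2 * Ds / q <= lam by rewrite (le_trans _ hlam)// lerDl.
  by rewrite ler_pdivrMr//; lra.
rewrite -!ml_kernel1.
have mono := ml_kernel1_nonincreasing alpha01 lam0.
have intJ t (t0 : 0 < t) := integrable_ml_kernel alpha01 lam0 ltr01 t0.
have JE t (t0 : 0 < t) := Rintegral_ml_kernel alpha01 lam0 ltr01 t0.
have B t (t0 : 0 < t) := ml_kernel2_bounds alpha01 lam0 t0.
have /andP[_ u1] := nonincreasing_Rintegral_mean S0 Sm1 mono (intJ _ m10).
have /andP[u2 _] := nonincreasing_Rintegral_mean m20 m2T mono (intJ _ T0).
rewrite (JE _ m10) (JE _ S0) in u1; rewrite (JE _ m20) (JE _ T0) in u2.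
have /andP[_ b1] := B _ m10; have /andP[_ b2] := B _ m20.
have /andP[b3 _] := B _ S0; have /andP[b4 _] := B _ T0.
rewrite -/(L _) -/(D _) in b1; rewrite -/(L _) -/(D _) in b2.
rewrite -/(L _) in b3; rewrite -/(L _) in b4.
have two : 1 + 1 = 2 :> R by [].
rewrite two in u1 u2.
rewrite hE1 in u1; rewrite hE2 in u2.
move: u1 u2 b1 b2 b3 b4.
move: (ml_kernel alpha lam 2 m1) (ml_kernel alpha lam 2 m2)
  (ml_kernel alpha lam 2 S) (ml_kernel alpha lam 2 T)
  (ml_kernel alpha lam 1 S) (ml_kernel alpha lam 1 T) => w1 w2 wS wT uS uT.
move=> u1 u2 b1 b2 b3 b4.
rewrite ler_pdivrMr; last exact: mulr_gt0.
have key : q / 2 <= lam * (w1 - wS - (wT - w2)) by lra.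
have e1 : Gamma 1 * (w1 - wS - (wT - w2)) <= h * (uS - uT) by lra.
have := ler_wpM2l (ltW G10) key; have := ler_wpM2l (ltW lam0) e1.
lra.
Qed.

End relaxation_gap.

(** * Uniqueness *)

Section source_term.
Context {R : realType}.
Notation mu := (@lebesgue_measure R).

(** After s |-> t - s the kernel is w, whose mass Gamma 1 W_(1+alpha)(t) is positive and at most 1 /
    lam. *)
Lemma source_integral_bounds (alpha lam t c C : R) (g : R -> R) :
  0 < alpha < 1 -> 0 < lam -> 0 < t -> 0 < c -> c <= C ->
  measurable_fun (`]0, +oo[ : set R) g ->
  {ae mu, forall s, 0 < s -> c <= g s <= C} ->
  let I := \int[mu]_(s in `[0, t]) ((t - s) `^ (alpha - 1) *
     mittag_leffler alpha alpha (- (lam * (t - s) `^ alpha)) * g s) in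
  0 < I /\ lam * I <= C.
Proof.
move=> alpha01 lam0 t0 c0 cC mg gcC.
have alpha0 : 0 < alpha by case/andP: alpha01.
pose w := ml_kernel alpha lam alpha.
have w_ge0 s : 0 <= w s by exact: ml_kernel_alpha_ge0.
have mw : measurable_fun setT w.
  by apply: measurable_ml_kernel.
have iw : mu.-integrable `[0, t] (EFin \o w) by exact: integrable_ml_kernel.
have [ih] := ge0_Rintegral_reflect mw w_ge0 iw.
rewrite (Rintegral_ml_kernel alpha01 lam0 alpha0 t0) (addrC alpha) => hE.
have mg' : measurable_fun `]0, t] g.
  by apply: measurable_funS mg => //; apply: subset_itvl; rewrite bnd_simp.
have := Rintegral_weight_bounds cC ih (fun s => w_ge0 (t - s)) mg' gcC.
rewrite hE => /andP[I1 I2]; split.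
  apply: lt_le_trans I1; apply: mulr_gt0 => //; apply: mulr_gt0; first exact: Gamma_gt0.
  exact: ml_kernel_1alpha_gt0.
have G1 : 0 < Gamma (1 : R) by exact: Gamma_gt0.
apply: (le_trans (ler_wpM2l (ltW lam0) I2)).
have := ler_wpM2l (ltW G1) (ml_kernel_1alpha_le alpha01 lam0 t0).
rewrite (mulfV (lt0r_neq0 G1)) => h1.
have := ler_wpM2l (ltW (lt_le_trans c0 cC)) h1; rewrite mulr1; apply: le_trans.
by rewrite mulrCA [lam * (_ * _)]mulrCA.
Qed.

End source_term.

Section uniqueness.
Context {R : realType}.
Variables (alpha : R) (lam : nat -> R) (gamma : R) (u0 : nat -> R) (g : R -> R).
Notation mu := (@lebesgue_measure R).
Hypotheses (alpha01 : 0 < alpha < 1) (spec : spectrum lam).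
Variables (c C : R).
Hypotheses (c0 : 0 < c) (cC : c <= C).
Hypothesis mg : measurable_fun (`]0, +oo[ : set R) g.
Hypothesis gcC : {ae mu, forall s, 0 < s -> c <= g s <= C}.

Let lam_ge0 n : lam 0%N <= lam n.
Proof. by case: spec => _ [mono _]; elim: n => // n ih; exact: le_trans (mono n). Qed.

Let lam_gt0 n : 0 < lam n.
Proof. by case: spec => l0 _; exact: lt_le_trans (lam_ge0 n). Qed.

(** Ensures that u0 can only fail to lie in S_gamma through the decay of its coefficients. The
    eigenvalues are bounded below by the first. *)
Lemma in_L2_Hdot_m2 : in_L2 u0 -> in_Hdot lam (-2) u0.
Proof.
rewrite /in_L2 /in_Hdot => h.
apply: (@series_le_cvg _ _ (lam 0%N `^ (-2) *: (fun n => u0 n ^+ 2))).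
- by move=> n; rewrite mulr_ge0 ?powR_ge0 ?sqr_ge0.
- by move=> n; rewrite mulr_ge0 ?powR_ge0 ?sqr_ge0.
- move=> n; rewrite ler_wpM2r ?sqr_ge0//.
  rewrite !powRN lef_pV2 ?posrE ?powR_gt0//.
  by rewrite ge0_ler_powR ?nnegrE ?(ltW (lam_gt0 _)).
- exact: is_cvg_seriesZ.
Qed.

Lemma initial_decay (S T : R) (psi chi : nat -> R) : 0 < S -> S < T ->
  (fun n => lam n `^ gamma * `|psi n|) @ \oo --> 0 ->
  (fun n => lam n `^ gamma * `|chi n|) @ \oo --> 0 ->
  (forall n, sol_coef alpha lam u0 g psi S n = sol_coef alpha lam u0 g chi T n) ->
  (fun n => lam n `^ gamma * `|u0 n|) @ \oo --> 0.
Proof.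
move=> S0 ST psi0 chi0 E; have T0 := lt_trans S0 ST.
have C0 : 0 < C := lt_le_trans c0 cC.
have [d d0 [Lam Lam0 gap]] := mittag_leffler1_gap alpha01 S0 ST.
(* [C] bounds lam_n times each source integral, and [d] bounds the scaled gap of the initial terms
   from below. *)
have lim0 : (fun n => C / d * (lam n `^ gamma * `|psi n| + lam n `^ gamma * `|chi n|))
    @ \oo --> 0.
  rewrite -(mulr0 (C / d)); apply: cvgM; first exact: cvg_cst.
  by rewrite -(addr0 0); exact: cvgD.
apply: (squeeze_cvgr _ (cvg_cst 0) lim0).
case: spec => _ [_ /cvgryPge/(_ Lam) big].
near=> n.
have Ln : Lam <= lam n by near: n.
have ln := lam_gt0 n.
apply/andP; split; first by rewrite mulr_ge0 ?powR_ge0.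
rewrite -mulrDr mulrCA ler_wpM2l ?powR_ge0// mulrAC ler_pdivlMr//.
have := E n; rewrite /sol_coef.
have [IS0 IS] := source_integral_bounds alpha01 ln S0 c0 cC mg gcC.
have [IT0 IT] := source_integral_bounds alpha01 ln T0 c0 cC mg gcC.
move: (gap _ Ln) IS0 IS IT0 IT.
set IS := Rintegral _ _ _; set IT := Rintegral _ _ _.
set ES := mittag_leffler _ _ _; set ET := mittag_leffler _ _ _.
move: IS IT ES ET => IS IT ES ET gapn IS0 hIS IT0 hIT En.
have eq1 : lam n * (ES - ET) * u0 n = chi n * (lam n * IT) - psi n * (lam n * IS).
  have -> : lam n * (ES - ET) * u0 n = lam n * (ES * u0 n - ET * u0 n) by ring.
  have -> : ES * u0 n - ET * u0 n = chi n * IT - psi n * IS by lra.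
  by ring.
have gp : 0 < lam n * (ES - ET) := lt_le_trans d0 gapn.
have lIS : 0 <= lam n * IS by rewrite mulr_ge0 ?ltW.
have lIT : 0 <= lam n * IT by rewrite mulr_ge0 ?ltW.
apply: (@le_trans _ _ `|lam n * (ES - ET) * u0 n|).
  by rewrite normrM (gtr0_norm gp) mulrC ler_wpM2r.
rewrite eq1 (le_trans (ler_normB _ _))// (normrM (chi n)) (normrM (psi n)).
rewrite (ger0_norm lIS) (ger0_norm lIT).
rewrite mulrDr addrC.
by apply: lerD; rewrite mulrC ler_wpM2r.
Unshelve. all: by end_near. Qed.

End uniqueness.

Theorem mainTheorem5 (R : realType) (alpha : R) (lam : nat -> R)
    (gamma : R) (u0 : nat -> R) (g : R -> R) (T Tt : R) (psi psit : nat -> R) :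
  0 < alpha < 1 ->
  spectrum lam ->
  0 <= gamma ->
  in_L2 u0 -> ~ S_set lam gamma u0 ->
  in_Linfty_pos g ->
  (exists cg : R, 0 < cg /\
     {ae @lebesgue_measure R, forall t, 0 < t -> cg <= g t}) ->
  0 < T -> 0 < Tt ->
  in_Hdot lam (-1) psi -> S_set lam gamma psi ->
  in_Hdot lam (-1) psit -> S_set lam gamma psit ->
  (forall n, sol_coef alpha lam u0 g psi T n = sol_coef alpha lam u0 g psit Tt n) ->
  T = Tt /\ psi = psit.
Proof.
move=> alpha01 spec _ u0L2 u0S [mg [M gM]] [c [c0 cg]] T0 Tt0 _ [_ psiS] _ [_ psitS] E.
pose C := Num.max c M.
have cC : c <= C by rewrite le_max lexx.
have gcC : {ae @lebesgue_measure R, forall s, 0 < s -> c <= g s <= C}.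
  apply: filterS2 cg gM; first exact: (ae_filter_ringOfSetsType (@lebesgue_measure R)).
  move=> s h1 h2 s0; rewrite h1//= le_max; apply/orP; right.
  by rewrite (le_trans (ler_norm _))// h2.
have TE : T = Tt.
  (* Distinct times would put u0 in S_gamma; the two orders of the times are symmetric under
     exchanging the sources. *)
  apply: contra_notP u0S => /eqP; rewrite neq_lt => TT.
  split; first exact: in_L2_Hdot_m2.
  case/orP: TT => TT; first exact: (initial_decay alpha01 spec c0 cC mg gcC T0 TT psiS psitS E).
  by apply: (initial_decay alpha01 spec c0 cC mg gcC Tt0 TT psitS psiS) => n; rewrite E.
split => //; apply/funext => n.
(* At equal times the initial terms cancel, and both sources are multiplied by the same positive
   integral. *)
have := E n; rewrite -TE /sol_coef => /addrI.
have l0 : 0 < lam n.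
  case: spec => l0 [mono _].
  suff : lam 0%N <= lam n by exact: lt_le_trans.
  by elim: n => // n ih; exact: le_trans (mono n).
have [I0 _] := source_integral_bounds alpha01 l0 T0 c0 cC mg gcC.
by apply: mulIf; rewrite gt_eqF.
Qed.
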